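(* Let $\rho \in \mathcal{S}$ with $\rho > 0$ and $\sigma \in \mathcal{P}$ with $\sigma > 0$, and let $\alpha \in (\frac12, 1)\cup(1,\infty)$. Then $D_{\alpha}^{\mathbb{M}}(\rho\|\sigma) \leq D_{\alpha}(\rho\|\sigma)$, with equality if and only if $\rho\sigma=\sigma\rho$.
   Context: Work on a $d$-dimensional complex Hilbert space; $\mathcal{P}$ positive semidefinite operators, $\mathcal{S}$ density operators, $\log$ natural logarithm. The sandwiched Rényi relative entropy is $D_\alpha(\rho\|\sigma)=\frac{1}{\alpha-1}\log \operatorname{tr}\big[(\sigma^{\frac{1-\alpha}{2\alpha}}\rho\sigma^{\frac{1-\alpha}{2\alpha}})^\alpha\big]$. The measured Rényi relative entropy is $D^{\mathbb{M}}_\alpha(\rho\|\sigma):=\sup_{(\mathcal{X},M)}\frac{1}{\alpha-1}\log\sum_{x}P_{\rho,M}(x)^\alpha P_{\sigma,M}(x)^{1-\alpha}$, supremum over finite sets $\mathcal{X}$ and POVMs $M$ on $\mathcal{X}$ (maps to positive semidefinite operators summing to the identity), with $P_{\rho,M}(x)=\operatorname{tr}[M(x)\rho]$ (terms with $P_{\rho,M}(x)=0$ contribute $0$). *)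

(* Defs.v *)
From Stdlib Require Import Reals List ClassicalEpsilon.
Import ListNotations.
Open Scope R_scope.

Record C := mkC { re : R; im : R }.
Definition C0 : C := mkC 0 0.
Definition C1 : C := mkC 1 0.
Definition RtoC (x : R) : C := mkC x 0.
Definition Cadd (a b : C) : C := mkC (re a + re b) (im a + im b).
Definition Cmul (a b : C) : C :=
  mkC (re a * re b - im a * im b) (re a * im b + im a * re b).
Definition Cconj (a : C) : C := mkC (re a) (- im a).

Definition Csum (n : nat) (f : nat -> C) : C :=
  fold_right Cadd C0 (map f (seq 0 n)).

(** Matrices: only the entries with indices < d are meaningful. *)
Definition Mat := nat -> nat -> C.
Definition mat_eq (d : nat) (A B : Mat) : Prop :=
  forall i j, (i < d)%nat -> (j < d)%nat -> A i j = B i j.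
Definition mmul (d : nat) (A B : Mat) : Mat :=
  fun i j => Csum d (fun k => Cmul (A i k) (B k j)).
Definition adj (A : Mat) : Mat := fun i j => Cconj (A j i).
Definition Id : Mat := fun i j => if Nat.eqb i j then C1 else C0.
Definition madd (A B : Mat) : Mat := fun i j => Cadd (A i j) (B i j).
Definition mzero : Mat := fun _ _ => C0.
Definition msum (Ms : list Mat) : Mat := fold_right madd mzero Ms.
Definition trace (d : nat) (A : Mat) : C := Csum d (fun i => A i i).
Definition diagm (lam : nat -> R) : Mat :=
  fun i j => if Nat.eqb i j then RtoC (lam i) else C0.

Definition qform (d : nat) (A : Mat) (v : nat -> C) : C :=
  Csum d (fun i => Cmul (Cconj (v i)) (Csum d (fun j => Cmul (A i j) (v j)))).

Definition hermitian (d : nat) (A : Mat) : Prop := mat_eq d A (adj A).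
Definition psd (d : nat) (A : Mat) : Prop :=
  hermitian d A /\ forall v, 0 <= re (qform d A v).
Definition posdef (d : nat) (A : Mat) : Prop :=
  hermitian d A /\
  forall v, (exists i, (i < d)%nat /\ v i <> C0) -> 0 < re (qform d A v).
Definition density (d : nat) (A : Mat) : Prop := psd d A /\ trace d A = C1.

Definition unitary (d : nat) (U : Mat) : Prop := mat_eq d (mmul d (adj U) U) Id.

(** real power with the convention 0^s = 0 on nonpositive arguments
    (only applied to eigenvalues / probabilities) *)
Definition rpow (x s : R) : R := if Rlt_dec 0 x then Rpower x s else 0.

Definition is_mpow (d : nat) (A : Mat) (s : R) (Q : Mat) : Prop :=
  exists (U : Mat) (lam : nat -> R),
    unitary d U /\ (forall i, (i < d)%nat -> 0 <= lam i) /\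
    mat_eq d A (mmul d (mmul d U (diagm lam)) (adj U)) /\
    mat_eq d Q (mmul d (mmul d U (diagm (fun i => rpow (lam i) s))) (adj U)).

Definition mpow (d : nat) (A : Mat) (s : R) : Mat :=
  epsilon (inhabits mzero) (is_mpow d A s).

Definition sandwiched (d : nat) (alpha : R) (rho sigma : Mat) : R :=
  let S := mpow d sigma ((1 - alpha) / (2 * alpha)) in
  / (alpha - 1) * ln (re (trace d (mpow d (mmul d (mmul d S rho) S) alpha))).

Definition povm (d : nat) (Ms : list Mat) : Prop :=
  Forall (psd d) Ms /\ mat_eq d (msum Ms) Id.

Definition prob (d : nat) (rho M : Mat) : R := re (trace d (mmul d M rho)).

Definition measured_value (d : nat) (alpha : R) (rho sigma : Mat)
  (Ms : list Mat) : R :=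
  / (alpha - 1) *
  ln (fold_right Rplus 0
        (map (fun M => let p := prob d rho M in let q := prob d sigma M in
                       if Req_EM_T p 0 then 0 else rpow p alpha * rpow q (1 - alpha))
             Ms)).

(** The set whose supremum is the measured Renyi relative entropy *)
Definition measured_values (d : nat) (alpha : R) (rho sigma : Mat) (v : R) : Prop :=
  exists Ms, povm d Ms /\ v = measured_value d alpha rho sigma Ms.

Definition commute (d : nat) (A B : Mat) : Prop := mat_eq d (mmul d A B) (mmul d B A).

(* Main.v *)
(** Write [beta = (alpha - 1) / alpha], so that [|beta| < 1], and
    [X = sigma^(-beta/2) rho sigma^(-beta/2)]; the sandwiched quantity is
    [Q = tr X^alpha].  For a POVM [M] with outcome probabilities [p], [q], put
    [w = (p / q)^alpha] and [W = sum_x w(x) M(x)].  Operator Jensen for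
    [t |-> t^beta] bounds the measured sum by
    [Psi(W) = alpha tr(rho W^beta) + (1 - alpha) tr(sigma W)]
    (from above if [alpha > 1], from below if [alpha < 1]).  With
    [Y = sigma^(beta/2) W^beta sigma^(beta/2)] we have [tr(rho W^beta) = tr(X Y)]; the
    trace Young inequality for [X] and [Y] followed by the Araki-Lieb-Thirring
    inequality [tr Y^(1/beta) <= tr(sigma W)] compares [Psi(W)] with [Q].

    Operator Jensen and Araki-Lieb-Thirring are both obtained by writing [t^(-theta)] as a
    positive integral of the resolvents [1 / (t + s)], for which the inequality is a
    completed square.  Equality in Araki-Lieb-Thirring makes all the squares vanish and
    forces [W] to commute with [sigma]; equality in Young makes [X] a function of [Y],
    hence [rho] commutes with [sigma].  As the spectra of the relevant [W] stay in a
    compact subset of the positive reals, a supremum equal to [Q] is reached by some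
    [W], so the equality analysis applies.  Conversely, if [rho] and [sigma] commute,
    measuring in a common eigenbasis attains [Q]. *)

From Stdlib Require Import Reals List Lra Psatz Lia ClassicalEpsilon.
From Coquelicot Require Import Rcomplements Hierarchy Continuity Derive AutoDerive.
From Coquelicot Require Import RInt RInt_analysis.

Local Open Scope R_scope.

(** * Powers as integrals of resolvents *)

(** A POVM may have any number of outcomes, so nearly optimal measurements have no evident limit.
    The operator [W] has fixed size and a spectrum bounded independently of the POVM; passing to it
    is what opens the equality case. The weight [w = (p / q)^alpha] is the stationary point of
    [w |-> alpha p w^beta + (1 - alpha) q w], whose value there is [p^alpha q^(1-alpha)].

    No matrix is ever integrated. Traces are expanded over eigenvalues, so that each operator
    inequality becomes the nonnegativity, for all [s > 0], of one finite signed sum of terms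
    [c / (t + s)], and only this real function of [s] is integrated. Its continuity then turns
    equality of the integrals into equality for every [s].

    The two regimes [alpha < 1] and [alpha > 1] reverse all the inequalities; multiplying each
    difference by [alpha - 1] lets one statement serve both. *)

Definition wsum (g : R -> R) (l : list (R * R)) : R :=
  fold_right (fun p r => fst p * g (snd p) + r) 0 l.

(** The integrand [s^(-th) / (t + s) ds] after the substitution [s = exp x]: it is continuous on the
    whole line, and rescaling [t] becomes a translation of [x]. *)
Definition kern (th t x : R) : R := exp ((1 - th) * x) / (t + exp x).

Lemma kern_continuous th t x : 0 < t -> continuous (kern th t) x.
Proof.
intros Ht; apply (ex_derive_continuous (kern th t)); unfold kern; auto_derive.
generalize (exp_pos x); lra.
Qed.

Lemma ex_RInt_kern th t a b : 0 < t -> ex_RInt (kern th t) a b.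
Proof.
intros Ht; apply (ex_RInt_continuous (V := R_CompleteNormedModule)).
intros x _; now apply kern_continuous.
Qed.

Lemma kern_pos th t x : 0 < t -> 0 < kern th t x.
Proof.
intros Ht; unfold kern; apply Rdiv_lt_0_compat; [apply exp_pos|].
generalize (exp_pos x); lra.
Qed.

Lemma is_RInt_exp c a b : c <> 0 ->
  is_RInt (fun x => exp (c * x)) a b (exp (c * b) / c - exp (c * a) / c).
Proof.
intros Hc; apply (is_RInt_derive (fun x => exp (c * x) / c)).
- intros x _; auto_derive; [easy|field; easy].
- intros x _; apply (ex_derive_continuous (fun x => exp (c * x))); auto_derive; easy.
Qed.

(** To the left of [0] the kernel is below [exp ((1 - th) x)], to the right below [exp (- th x)].
    Any bound uniform in the interval will do, as it only feeds a completeness argument. *)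
Lemma RInt_kern_bound th : 0 < th < 1 -> forall a b, a <= b ->
  RInt (kern th 1) a b <= / (1 - th) + / th.
Proof.
intros Hth.
assert (Hl : forall a, a <= 0 -> RInt (kern th 1) a 0 <= / (1 - th)).
{ intros a Ha.
  apply Rle_trans with (RInt (fun x => exp ((1 - th) * x)) a 0).
  - apply RInt_le; try easy.
    + apply ex_RInt_kern; lra.
    + eexists; apply is_RInt_exp; lra.
    + intros x _; unfold kern.
      rewrite <- (Rmult_1_r (exp ((1 - th) * x))) at 2.
      apply Rmult_le_compat_l; [left; apply exp_pos|].
      rewrite <- Rinv_1; apply Rinv_le_contravar; generalize (exp_pos x); lra.
  - rewrite (is_RInt_unique _ _ _ _ (is_RInt_exp (1 - th) a 0 ltac:(lra))).
    rewrite Rmult_0_r, exp_0.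
    assert (0 < exp ((1 - th) * a) / (1 - th)).
    { apply Rdiv_lt_0_compat; [apply exp_pos|lra]. }
    unfold Rdiv in *; lra. }
assert (Hr : forall b, 0 <= b -> RInt (kern th 1) 0 b <= / th).
{ intros b Hb.
  apply Rle_trans with (RInt (fun x => exp ((- th) * x)) 0 b).
  - apply RInt_le; try easy.
    + apply ex_RInt_kern; lra.
    + eexists; apply is_RInt_exp; lra.
    + intros x _; unfold kern.
      apply Rle_div_l; [generalize (exp_pos x); lra|].
      rewrite Rmult_plus_distr_l, <- exp_plus.
      replace (- th * x + x) with ((1 - th) * x) by ring.
      generalize (exp_pos (- th * x)); lra.
  - rewrite (is_RInt_unique _ _ _ _ (is_RInt_exp (- th) 0 b ltac:(lra))).
    rewrite Rmult_0_r, exp_0.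
    assert (0 < exp (- th * b) / th).
    { apply Rdiv_lt_0_compat; [apply exp_pos|lra]. }
    replace (exp (- th * b) / - th - 1 / - th)
      with (/ th - exp (- th * b) / th) by (field; lra).
    lra. }
assert (Hge : forall a b, a <= b -> 0 <= RInt (kern th 1) a b).
{ intros a b Hab; apply RInt_ge_0; auto.
  - apply ex_RInt_kern; lra.
  - intros x _; left; apply kern_pos; lra. }
intros a b Hab.
assert (Hex : forall u v, ex_RInt (kern th 1) u v) by (intros; apply ex_RInt_kern; lra).
(* The interval is enlarged to contain [0], which cannot decrease the integral of a positive
   kernel. *)
set (a' := Rmin a 0); set (b' := Rmax b 0).
assert (a' <= a /\ a' <= 0) as [Ha1 Ha2] by (split; [apply Rmin_l|apply Rmin_r]).
assert (b <= b' /\ 0 <= b') as [Hb1 Hb2] by (split; [apply Rmax_l|apply Rmax_r]).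
assert (E1 := RInt_Chasles (kern th 1) a' a b' (Hex _ _) (Hex _ _)).
assert (E2 := RInt_Chasles (kern th 1) a b b' (Hex _ _) (Hex _ _)).
assert (E3 := RInt_Chasles (kern th 1) a' 0 b' (Hex _ _) (Hex _ _)).
unfold plus in *; simpl in *.
generalize (Hl a' Ha2) (Hr b' Hb2) (Hge a' a Ha1) (Hge b b' Hb1); lra.
Qed.

Lemma RInt_kern_mono th a b a' b' : a' <= a -> a <= b -> b <= b' ->
  RInt (kern th 1) a b <= RInt (kern th 1) a' b'.
Proof.
intros H1 H2 H3.
assert (Hex : forall u v, ex_RInt (kern th 1) u v) by (intros; apply ex_RInt_kern; lra).
assert (Hge : forall a b, a <= b -> 0 <= RInt (kern th 1) a b).
{ intros u v Hab; apply RInt_ge_0; auto.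
  intros x _; left; apply kern_pos; lra. }
assert (E1 := RInt_Chasles (kern th 1) a' a b' (Hex _ _) (Hex _ _)).
assert (E2 := RInt_Chasles (kern th 1) a b b' (Hex _ _) (Hex _ _)).
unfold plus in *; simpl in *.
generalize (Hge a' a H1) (Hge b b' H3); lra.
Qed.

Lemma RInt_kern_scale th t a b : 0 < t ->
  RInt (kern th t) a b = Rpower t (- th) * RInt (kern th 1) (a - ln t) (b - ln t).
Proof.
intros Ht.
assert (Hex : forall u v, ex_RInt (kern th 1) u v) by (intros; apply ex_RInt_kern; lra).
rewrite <- (RInt_scal (V := R_CompleteNormedModule)) by apply Hex.
replace (a - ln t) with (1 * a + - ln t) by ring.
replace (b - ln t) with (1 * b + - ln t) by ring.
rewrite <- RInt_comp_lin.
2: { apply (ex_RInt_scal (V := R_NormedModule)), Hex. }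
apply RInt_ext; intros x _.
unfold scal; simpl; unfold mult; simpl; unfold kern, Rpower.
replace (1 * x + - ln t) with (x - ln t) by ring.
assert (E : exp (x - ln t) = exp x / t).
{ unfold Rminus; rewrite exp_plus, exp_Ropp, exp_ln by easy; reflexivity. }
rewrite E.
replace ((1 - th) * (x - ln t)) with ((1 - th) * x + (- (ln t)) + th * ln t) by ring.
rewrite !exp_plus, exp_Ropp, exp_ln by easy.
replace (exp (th * ln t)) with (/ exp (- th * ln t)).
2: { rewrite <- exp_Ropp; f_equal; ring. }
generalize (exp_pos x) (exp_pos (- th * ln t)); intros.
field; lra.
Qed.

(* [t ^ (-th)] is, up to the constant factor [c], the integral of
   [exp ((1 - th) x) / (t + exp x)] over the real line. *)
Lemma RInt_kern_limit th : 0 < th < 1 -> exists c, 0 < c /\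
  forall t, 0 < t -> forall eps, 0 < eps -> exists N, forall n, N <= n ->
    Rabs (RInt (kern th t) (- n) n - c * Rpower t (- th)) < eps.
Proof.
intros Hth.
(* The supremum [c] of the integrals over bounded intervals stands for the improper integral at
   [t = 1]. *)
set (E := fun v => exists a b, a <= b /\ v = RInt (kern th 1) a b).
destruct (completeness E) as [c [Hub Hlub]].
{ exists (/ (1 - th) + / th); intros v (a & b & Hab & ->); now apply RInt_kern_bound. }
{ exists (RInt (kern th 1) 0 0), 0, 0; split; [lra|easy]. }
exists c; split.
{ apply Rlt_le_trans with (RInt (kern th 1) 0 1).
  - apply RInt_gt_0; [lra| |].
    + intros x _; apply kern_pos; lra.
    + intros x _; apply kern_continuous; lra.
  - apply Hub; exists 0, 1; split; [lra|easy]. }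
intros t Ht eps Heps.
set (p := Rpower t (- th)).
assert (Hp : 0 < p) by apply exp_pos.
assert (exists a b, a <= b /\ c - eps / p < RInt (kern th 1) a b) as (a & b & Hab & Hc).
{ apply Classical_Prop.NNPP; intros Hn.
  assert (c <= c - eps / p).
  { apply Hlub; intros v (a & b & Hab & ->).
    apply Rnot_lt_le; intros Hlt; apply Hn; now exists a, b. }
  assert (0 < eps / p) by now apply Rdiv_lt_0_compat.
  lra. }
(* From this bound on, the window [[-n - ln t, n - ln t]] contains [[a, b]], so its integral lies
   between [c - eps / p] and [c]. *)
exists (Rabs a + Rabs b + Rabs (ln t)); intros n Hn.
rewrite RInt_kern_scale by easy; fold p.
generalize (Rle_abs a) (Rle_abs b) (Rle_abs (ln t)) (Rle_abs (- a)) (Rle_abs (- b))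
  (Rle_abs (- ln t)) (Rabs_pos a) (Rabs_pos b) (Rabs_pos (ln t)).
rewrite !Rabs_Ropp; intros.
assert (H9 : RInt (kern th 1) a b <= RInt (kern th 1) (- n - ln t) (n - ln t)).
{ apply RInt_kern_mono; lra. }
assert (H10 : RInt (kern th 1) (- n - ln t) (n - ln t) <= c).
{ apply Hub; exists (- n - ln t), (n - ln t); split; [lra|easy]. }
set (J := RInt (kern th 1) (- n - ln t) (n - ln t)) in *.
replace (p * J - c * p) with (- (p * (c - J))) by ring.
rewrite Rabs_Ropp, Rabs_pos_eq by (apply Rmult_le_pos; lra).
replace eps with (p * (eps / p)) by (field; lra).
apply Rmult_lt_compat_l; lra.
Qed.

Lemma is_RInt_wsum th l a b : (forall p, In p l -> 0 < snd p) ->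
  is_RInt (fun x => wsum (fun t => kern th t x) l) a b
    (wsum (fun t => RInt (kern th t) a b) l).
Proof.
induction l as [|p l IH]; intros Hl; simpl.
- generalize (is_RInt_const (V := R_NormedModule) a b 0).
  unfold scal; simpl; unfold mult; simpl; rewrite Rmult_0_r; easy.
- apply (is_RInt_plus (V := R_NormedModule)).
  + apply (is_RInt_scal (V := R_NormedModule)).
    apply (RInt_correct (V := R_CompleteNormedModule)), ex_RInt_kern, Hl; now left.
  + apply IH; intros q Hq; apply Hl; now right.
Qed.

Lemma wsum_kern th l x :
  wsum (fun t => kern th t x) l =
  exp ((1 - th) * x) * wsum (fun t => / (t + exp x)) l.
Proof.
induction l as [|p l IH]; simpl; [ring|]; rewrite IH; unfold kern, Rdiv; ring.
Qed.

Lemma continuous_wsum th l x : (forall p, In p l -> 0 < snd p) ->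
  continuous (fun x => wsum (fun t => kern th t x) l) x.
Proof.
induction l as [|p l IH]; intros Hl; simpl.
- apply continuous_const.
- apply (continuous_plus (V := R_NormedModule)).
  + apply (continuous_scal_r (V := R_NormedModule)), kern_continuous, Hl; now left.
  + apply IH; intros q Hq; apply Hl; now right.
Qed.

Lemma wsum_kern_limit th l : 0 < th < 1 -> (forall p, In p l -> 0 < snd p) ->
  exists c, 0 < c /\
  forall eps, 0 < eps -> exists N, forall n, N <= n ->
    Rabs (wsum (fun t => RInt (kern th t) (- n) n) l
          - c * wsum (fun t => Rpower t (- th)) l) < eps.
Proof.
intros Hth Hl; destruct (RInt_kern_limit th Hth) as (c & Hc & H); exists c; split; [easy|].
induction l as [|p l IH]; intros eps Heps; simpl.
- exists 0; intros n _; rewrite Rmult_0_r, Rminus_0_r, Rabs_R0; easy.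
- destruct (IH (fun q Hq => Hl q (or_intror Hq)) (eps / 2) ltac:(lra)) as [N HN].
  set (k := Rabs (fst p) + 1).
  assert (Hk : 0 < k) by (unfold k; generalize (Rabs_pos (fst p)); lra).
  destruct (H (snd p) (Hl p (or_introl eq_refl)) (eps / (2 * k))) as [N' HN'].
  { apply Rdiv_lt_0_compat; lra. }
  exists (Rmax N N'); intros n Hn.
  specialize (HN n (Rle_trans _ _ _ (Rmax_l _ _) Hn)).
  specialize (HN' n (Rle_trans _ _ _ (Rmax_r _ _) Hn)).
  set (u := RInt _ _ _) in *; set (s := wsum (fun t => RInt _ _ _) l) in *.
  set (v := Rpower _ _) in *; set (s' := wsum _ l) in *.
  replace (fst p * u + s - c * (fst p * v + s'))
    with (fst p * (u - c * v) + (s - c * s')) by ring.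
  eapply Rle_lt_trans; [apply Rabs_triang|].
  rewrite Rabs_mult.
  assert (Rabs (fst p) * Rabs (u - c * v) <= k * (eps / (2 * k))).
  { apply Rmult_le_compat; try apply Rabs_pos; [unfold k; lra|lra]. }
  replace (k * (eps / (2 * k))) with (eps / 2) in H0 by (field; lra).
  lra.
Qed.

(** The coefficients may have any sign; only the whole sum is nonnegative. Multiplied by
    [exp ((1 - th) x)] it is a continuous nonnegative integrand whose integrals tend to [c] times
    the power sum, so a zero power sum forces it to vanish pointwise. *)
Lemma wsum_resolvent_power th l : 0 < th < 1 -> (forall p, In p l -> 0 < snd p) ->
  (forall s, 0 < s -> 0 <= wsum (fun t => / (t + s)) l) ->
  0 <= wsum (fun t => Rpower t (- th)) l /\
  (wsum (fun t => Rpower t (- th)) l = 0 ->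
   forall s, 0 < s -> wsum (fun t => / (t + s)) l = 0).
Proof.
intros Hth Hl Hs.
set (f := fun x => wsum (fun t => kern th t x) l).
assert (Hf : forall x, 0 <= f x).
{ intros x; unfold f; rewrite wsum_kern; apply Rmult_le_pos; [left; apply exp_pos|].
  apply Hs, exp_pos. }
assert (HI : forall a b, is_RInt f a b (wsum (fun t => RInt (kern th t) a b) l)).
{ intros a b; now apply is_RInt_wsum. }
destruct (wsum_kern_limit th l Hth Hl) as (c & Hc & Hlim).
set (T := wsum (fun t => Rpower t (- th)) l) in *.
assert (Hpos : forall a b, a <= b -> 0 <= RInt f a b).
{ intros a b Hab; apply RInt_ge_0; auto; eexists; apply HI. }
split.
- apply Rnot_lt_le; intros HT.
  destruct (Hlim (- (c * T))) as [N HN].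
  { generalize (Rmult_lt_compat_l c _ _ Hc HT); lra. }
  set (n := Rmax N 0).
  specialize (HN n (Rmax_l _ _)).
  rewrite <- (is_RInt_unique _ _ _ _ (HI (- n) n)) in HN.
  assert (0 <= n) by apply Rmax_r.
  generalize (Hpos (- n) n ltac:(lra)) (Rle_abs (RInt f (- n) n - c * T)); lra.
- intros HT s Hs0; rewrite <- (exp_ln s Hs0).
  set (x0 := ln s).
  cut (f x0 = 0).
  { unfold f; rewrite wsum_kern; intros E.
    apply Rmult_integral in E; destruct E as [E|E]; [|easy].
    generalize (exp_pos ((1 - th) * x0)); lra. }
  apply Rle_antisym; [|apply Hf].
  apply Rnot_lt_le; intros Hx0.
  assert (Hcont : continuous f x0) by now apply continuous_wsum.
  destruct (proj1 (filterlim_locally f (f x0)) Hcont (mkposreal (f x0 / 2) ltac:(lra)))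
    as [d Hd].
  simpl in Hd.
  (* Inside [[x0 - e, x0 + e]] the integrand exceeds [f x0 / 2], so this interval has mass at least
     [e * f x0]; every larger window keeps it, against the limit [0]. *)
  set (e := d / 2).
  assert (He : 0 < e) by (unfold e; generalize (cond_pos d); lra).
  assert (Hle : e * f x0 <= RInt f (x0 - e) (x0 + e)).
  { replace (e * f x0) with (RInt (fun _ => f x0 / 2) (x0 - e) (x0 + e)).
    - apply RInt_le; [lra|apply ex_RInt_const|eexists; apply HI|].
      intros x Hx.
      assert (B : Rabs (f x - f x0) < f x0 / 2).
      { apply Hd; unfold ball; simpl; unfold AbsRing_ball, abs, minus, plus, opp; simpl.
        apply Rabs_def1; unfold e in *; lra. }
      apply Rabs_def2 in B; lra.
    - rewrite RInt_const; unfold scal; simpl; unfold mult; simpl; field. }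
  assert (0 < e * f x0) by now apply Rmult_lt_0_compat.
  destruct (Hlim (e * f x0) H) as [N HN].
  rewrite HT, Rmult_0_r in HN.
  set (n := Rmax N (Rabs x0 + e)).
  specialize (HN n (Rmax_l _ _)).
  rewrite <- (is_RInt_unique _ _ _ _ (HI (- n) n)), Rminus_0_r in HN.
  assert (Hn : Rabs x0 + e <= n) by apply Rmax_r.
  generalize (Rle_abs x0) (Rle_abs (- x0)); rewrite Rabs_Ropp; intros.
  assert (Hex : forall u v, ex_RInt f u v) by (intros; eexists; apply HI).
  assert (E1 := RInt_Chasles f (- n) (x0 - e) n (Hex _ _) (Hex _ _)).
  assert (E2 := RInt_Chasles f (x0 - e) (x0 + e) n (Hex _ _) (Hex _ _)).
  unfold plus in *; simpl in *.
  generalize (Hpos (- n) (x0 - e) ltac:(lra)) (Hpos (x0 + e) n ltac:(lra))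
    (Rle_abs (RInt f (- n) n)); lra.
Qed.

(** * Weighted arithmetic-geometric mean inequality *)

(** The tangent of the exponential gives [w >= m (1 + ln w - ln m)] for the geometric mean [m];
    averaging over [w = u] and [w = v] leaves [m]. The tangent bound is strict off the point of
    contact, whence the equality case. *)
Lemma Rpower_young u v g : 0 < u -> 0 < v -> 0 < g < 1 ->
  Rpower u g * Rpower v (1 - g) <= g * u + (1 - g) * v /\
  (Rpower u g * Rpower v (1 - g) = g * u + (1 - g) * v -> u = v).
Proof.
intros Hu Hv Hg.
set (m := Rpower u g * Rpower v (1 - g)).
assert (Hm : 0 < m) by (apply Rmult_lt_0_compat; apply exp_pos).
assert (Lm : ln m = g * ln u + (1 - g) * ln v).
{ unfold m; rewrite ln_mult by apply exp_pos; unfold Rpower; now rewrite !ln_exp. }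
assert (Hle : forall w, 0 < w -> m * (1 + (ln w - ln m)) <= w /\
  (m * (1 + (ln w - ln m)) = w -> ln w = ln m)).
{ intros w Hw.
  assert (E : m * exp (ln w - ln m) = w).
  { unfold Rminus; rewrite exp_plus, exp_Ropp, !exp_ln by easy; field; lra. }
  split.
  - rewrite <- E at 2; apply Rmult_le_compat_l; [lra|]; apply exp_ineq1_le.
  - intros Heq; apply Rminus_diag_uniq; apply Classical_Prop.NNPP; intros Hne.
    assert (H := exp_ineq1 _ Hne).
    rewrite <- E in Heq at 2; apply Rmult_eq_reg_l in Heq; lra. }
destruct (Hle u Hu) as [U1 U2]; destruct (Hle v Hv) as [V1 V2].
assert (E : g * (m * (1 + (ln u - ln m))) + (1 - g) * (m * (1 + (ln v - ln m))) = m).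
{ rewrite Lm; ring. }
assert (W1 := Rmult_le_compat_l g _ _ ltac:(lra) U1).
assert (W2 := Rmult_le_compat_l (1 - g) _ _ ltac:(lra) V1).
split; [lra|]; intros Heq.
apply ln_inv; [easy|easy|].
rewrite U2, V2; [easy| |].
- apply (Rmult_eq_reg_l (1 - g)); lra.
- apply (Rmult_eq_reg_l g); lra.
Qed.

(** * Convergent subsequences *)

Lemma choice_nat (T : Type) (P : nat -> T -> Prop) :
  (forall m, exists x, P m x) -> exists f, forall m, P m (f m).
Proof.
intros H; exists (fun m => proj1_sig (constructive_indefinite_description _ (H m))).
intros m; exact (proj2_sig (constructive_indefinite_description _ (H m))).
Qed.

Lemma Un_cv_subseq u l phi : (forall m, (m <= phi m)%nat) -> Un_cv u l ->
  Un_cv (fun m => u (phi m)) l.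
Proof.
intros Hphi Hu eps Heps; destruct (Hu eps Heps) as [N HN]; exists N.
intros m Hm; apply HN; specialize (Hphi m); lia.
Qed.

(** The index [phi m] is one past [m] whose term is within [1 / (m + 1)] of an accumulation point.
    The condition [m <= phi m] suffices to carry limits to subsequences and is stable under
    composition. *)
Lemma bounded_real_subsequence u B : (forall m, Rabs (u m) <= B) ->
  exists phi l, (forall m : nat, (m <= phi m)%nat) /\ Un_cv (fun m => u (phi m)) l.
Proof.
intros HB.
destruct (Bolzano_Weierstrass u _ (compact_P3 (- B) B)) as [l Hl].
{ intros m; specialize (HB m); apply Rabs_le_between in HB; exact HB. }
assert (Hex : forall m, exists p, (m <= p)%nat /\ Rabs (u p - l) < / (INR m + 1)).
{ intros m.
  assert (Hm : 0 < / (INR m + 1)) by (apply Rinv_0_lt_compat; generalize (pos_INR m); lra).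
  destruct (Hl (disc l (mkposreal _ Hm)) m) as [p Hp].
  { exists (mkposreal _ Hm); intros x Hx; exact Hx. }
  exists p; exact Hp. }
destruct (choice_nat _ _ Hex) as [phi Hphi]; exists phi, l; split.
- intros m; apply Hphi.
- intros eps Heps.
  destruct (archimed_cor1 eps Heps) as [N [HN HN0]]; exists N; intros m Hm.
  unfold Rdist; eapply Rlt_trans; [apply Hphi|]; eapply Rle_lt_trans; [|exact HN].
  apply Rinv_le_contravar; [apply lt_0_INR; lia|].
  apply le_INR in Hm; lra.
Qed.

Lemma bounded_subsequence (J : Type) (s : list J) (f : nat -> J -> R) B :
  (forall m j, Rabs (f m j) <= B) ->
  exists phi, (forall m : nat, (m <= phi m)%nat) /\
    forall j, In j s -> exists l, Un_cv (fun m => f (phi m) j) l.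
Proof.
intros HB; induction s as [|j s (phi & Hphi & IH)].
- exists (fun m => m); split; [intros; lia|intros j []].
- destruct (bounded_real_subsequence (fun m => f (phi m) j) B) as (psi & l & Hpsi & Hl).
  { intros m; apply HB. }
  exists (fun m => phi (psi m)); split.
  { intros m; specialize (Hphi (psi m)); specialize (Hpsi m); lia. }
  intros k [<-|Hk]; [now exists l|].
  destruct (IH k Hk) as [l' Hl']; exists l'.
  now apply (Un_cv_subseq (fun m => f (phi m) k)).
Qed.

Lemma Un_cv_Rpower u l s : 0 < l -> Un_cv u l ->
  Un_cv (fun m => Rpower (u m) s) (Rpower l s).
Proof.
intros Hl Hu.
apply (continuity_seq (fun x => Rpower x s)); [|exact Hu].
apply derivable_continuous_pt; exists (s * Rpower l (s - 1)).
now apply derivable_pt_lim_power.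
Qed.

Lemma Un_cv_const c : Un_cv (fun _ => c) c.
Proof.
intros eps Heps; exists 0%nat; intros m _; rewrite (proj2 (Rdist_refl c c)); easy.
Qed.

Close Scope R_scope.

From mathcomp Require Import all_boot all_order all_algebra.
From mathcomp Require Import Rstruct complex.
From mathcomp Require Import ring lra.
Require Import Defs.

Set Implicit Arguments.
Unset Strict Implicit.
Unset Printing Implicit Defensive.
Import Order.TTheory GRing.Theory Num.Theory.
Local Open Scope ring_scope.
Local Open Scope sesquilinear_scope.

(** * Spectral calculus of hermitian matrices *)

Section Spectral.
Variable C : numClosedFieldType.
Variable n : nat.
Implicit Types (A B M U P : 'M[C]_n) (a b : 'I_n -> C).

Definition dg a : 'M[C]_n := diag_mx (\row_i a i).
Definition spm U a : 'M[C]_n := U *m dg a *m U^t*.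

Lemma adjM m p q (A : 'M[C]_(m, p)) (B : 'M[C]_(p, q)) :
  (A *m B)^t* = B^t* *m A^t*.
Proof. by rewrite trmx_mul map_mxM. Qed.

Lemma adjE m p (A : 'M[C]_(m, p)) i j : A^t* i j = (A j i)^*.
Proof. by rewrite !mxE. Qed.

Lemma unitary_mulVmx U : U \is unitarymx -> U^t* *m U = 1%:M.
Proof. by move=> /unitarymxP /mulmx1C. Qed.

Lemma dg_mulE a M i j : (dg a *m M) i j = a i * M i j.
Proof. by rewrite mul_diag_mx !mxE. Qed.

Lemma mul_dgE a M i j : (M *m dg a) i j = M i j * a j.
Proof. by rewrite mul_mx_diag !mxE. Qed.

Lemma dgM a b : dg a *m dg b = dg (fun i => a i * b i).
Proof. by apply/matrixP=> i j; rewrite dg_mulE !mxE mulrnAr. Qed.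

Lemma dgC (c : C) : dg (fun=> c) = c%:M.
Proof. by apply/matrixP=> i j; rewrite !mxE. Qed.

Lemma dgZ (c : C) a : dg (fun i => c * a i) = c *: dg a.
Proof. by apply/matrixP=> i j; rewrite !mxE mulrnAr. Qed.

Lemma dgD a b : dg (fun i => a i + b i) = dg a + dg b.
Proof. by apply/matrixP=> i j; rewrite !mxE mulrnDl. Qed.

Lemma eq_dg a b : a =1 b -> dg a = dg b.
Proof. by move=> h; apply/matrixP=> i j; rewrite !mxE h. Qed.

Lemma adj_dg a : (forall i, a i \is Num.real) -> (dg a)^t* = dg a.
Proof.
move=> ra; apply/matrixP=> i j; rewrite adjE !mxE eq_sym.
by case: eqP => [->|_]; rewrite ?mulr0n ?mulr1n ?conjC0 ?conj_Creal.
Qed.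

Lemma adj_spm U a : (forall i, a i \is Num.real) -> (spm U a)^t* = spm U a.
Proof. by move=> ra; rewrite /spm !adjM adj_dg // trmxCK mulmxA. Qed.

Lemma spmM U a b : U \is unitarymx ->
  spm U a *m spm U b = spm U (fun i => a i * b i).
Proof.
move=> uU; rewrite /spm -dgM !mulmxA.
by rewrite -(mulmxA (U *m dg a)) unitary_mulVmx // mulmx1.
Qed.

Lemma spmC U (c : C) : U \is unitarymx -> spm U (fun=> c) = c%:M.
Proof.
move=> uU; rewrite /spm dgC mul_mx_scalar -scalemxAl (unitarymxP uU).
by rewrite scalemx1.
Qed.

Lemma spmD U a b : spm U (fun i => a i + b i) = spm U a + spm U b.
Proof. by rewrite /spm dgD mulmxDr mulmxDl. Qed.

Lemma spmZ U (c : C) a : spm U (fun i => c * a i) = c *: spm U a.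
Proof. by rewrite /spm dgZ -scalemxAr -scalemxAl. Qed.

Lemma eq_spm U a b : a =1 b -> spm U a = spm U b.
Proof. by move=> /eq_dg e; rewrite /spm e. Qed.

Lemma tr_dg a : \tr (dg a) = \sum_i a i.
Proof. by apply: eq_bigr => i _; rewrite !mxE eqxx mulr1n. Qed.

Lemma tr_spm U a : U \is unitarymx -> \tr (spm U a) = \sum_i a i.
Proof.
by move=> uU; rewrite /spm mxtrace_mulC mulmxA unitary_mulVmx // mul1mx tr_dg.
Qed.

Lemma tr_dg_quad a b M :
  \tr (dg a *m M *m dg b *m M^t*) =
  \sum_i \sum_j a i * b j * `|M i j| ^+ 2.
Proof.
apply: eq_bigr => i _; rewrite mxE; apply: eq_bigr => j _.
by rewrite mul_dgE dg_mulE adjE normCK mulrA (mulrAC (a i)).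
Qed.

Lemma tr_spm2 U P a b :
  \tr (spm U a *m spm P b) =
  \sum_i \sum_j a i * b j * `|(U^t* *m P) i j| ^+ 2.
Proof.
rewrite -tr_dg_quad adjM trmxCK /spm -!mulmxA mxtrace_mulC.
by rewrite -!mulmxA.
Qed.

Lemma tr_mul_spm A U a :
  \tr (A *m spm U a) = \sum_k a k * (U^t* *m A *m U) k k.
Proof.
rewrite /spm !mulmxA mxtrace_mulC !mulmxA.
by apply: eq_bigr => k _; rewrite mul_dgE mulrC.
Qed.

Lemma hermitian_spectral A : A^t* = A ->
  exists U a, [/\ U \is unitarymx, forall i, a i \is Num.real & A = spm U a].
Proof.
move=> hA.
have hh : A \is hermsymmx.
  by apply/is_hermitianmxP; rewrite expr0 scale1r hA.
have /orthomx_spectralP E := hermitian_normalmx hh.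
have ru := hermitian_spectral_diag_real hh.
exists ((spectralmx A)^t* ), (fun i => spectral_diag A 0 i).
rewrite trmxC_unitary spectral_unitarymx; split=> // [i|].
  by move/mxOverP: ru; apply.
rewrite [LHS]E invmx_unitary ?spectral_unitarymx // /spm trmxCK.
by congr (_ *m _ *m _); apply/matrixP=> i j; rewrite !mxE.
Qed.

(* [M diag(a) = diag(b) M] says that [M i j = 0] unless [b i = a j]. *)
Lemma intertwine_fun (f : C -> C) a b M : M *m dg a = dg b *m M ->
  M *m dg (f \o a) = dg (f \o b) *m M.
Proof.
move=> h; apply/matrixP=> i j; rewrite mul_dgE dg_mulE /=.
have /matrixP /(_ i j) := h; rewrite mul_dgE dg_mulE mulrC => /eqP.
rewrite -subr_eq0 -mulrBl mulf_eq0 => /orP[|/eqP ->]; last by rewrite mul0r mulr0.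
by rewrite subr_eq0 => /eqP ->; rewrite mulrC.
Qed.

Lemma conj_unitaryK U M : U \is unitarymx -> U *m (U^t* *m M *m U) *m U^t* = M.
Proof.
move=> uU; rewrite !mulmxA (unitarymxP uU) mul1mx.
by rewrite -mulmxA (unitarymxP uU) mulmx1.
Qed.

(** The unitary [E] between two eigenbases intertwines the diagonals, hence also their images under
    [f]: the functional calculus does not depend on the diagonalization. *)
Lemma spm_fun (f : C -> C) U P a b : U \is unitarymx -> P \is unitarymx ->
  spm U a = spm P b -> spm U (f \o a) = spm P (f \o b).
Proof.
move=> uU uP h; pose E := P^t* *m U.
have uE : E \is unitarymx by rewrite mul_unitarymx ?trmxC_unitary.
have UE : U = P *m E by rewrite /E mulmxA (unitarymxP uP) mul1mx.
have spE c : spm U c = P *m spm E c *m P^t*.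
  by rewrite /spm {1 2}UE adjM !mulmxA.
have e : E *m dg a = dg b *m E.
  have : spm E a = dg b.
    have := congr1 (fun X => P^t* *m X *m P) h; rewrite spE /= /spm.
    rewrite !mulmxA unitary_mulVmx // !mul1mx.
    by rewrite -!(mulmxA _ (P^t* ) P) unitary_mulVmx // !mulmx1.
  move=> <-; rewrite /spm -(mulmxA _ (E^t* ) E) unitary_mulVmx //.
  by rewrite mulmx1.
rewrite spE [in RHS]/spm; congr (_ *m _ *m _).
by rewrite /spm (intertwine_fun f e) -mulmxA (unitarymxP uE) mulmx1.
Qed.

(** In the eigenbasis, [M] has no entry between distinct eigenvalues, and the other entries see
    equal values of [f]. *)
Lemma commute_spm_fun (f : C -> C) M U a : U \is unitarymx ->
  M *m spm U a = spm U a *m M -> M *m spm U (f \o a) = spm U (f \o a) *m M.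
Proof.
move=> uU h; pose E := U^t* *m M *m U.
have ME : M = U *m E *m U^t* by rewrite conj_unitaryK.
have l c : U^t* *m (M *m spm U c) *m U = E *m dg c.
  rewrite /E /spm !mulmxA -!(mulmxA _ (U^t* ) U) unitary_mulVmx //.
  by rewrite mulmx1.
have r c : U^t* *m (spm U c *m M) *m U = dg c *m E.
  by rewrite /E /spm !mulmxA unitary_mulVmx // mul1mx.
have e : E *m dg a = dg a *m E by rewrite -l h r.
rewrite -[LHS](conj_unitaryK _ uU) l (intertwine_fun f e) -r.
by rewrite conj_unitaryK.
Qed.

Lemma unitary_sum_row U i : U \is unitarymx -> \sum_j `|U i j| ^+ 2 = 1.
Proof.
move=> /unitarymxP /matrixP /(_ i i); rewrite !mxE eqxx => h; rewrite -[RHS]/(true%:R : C) -h.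
by apply: eq_bigr => j _; rewrite adjE normCK.
Qed.

Lemma unitary_sum_col U j : U \is unitarymx -> \sum_i `|U i j| ^+ 2 = 1.
Proof.
move=> uU; rewrite -(@unitary_sum_row (U^t* ) j) ?trmxC_unitary //.
by apply: eq_bigr => i _; rewrite adjE norm_conjC.
Qed.

(* Overlaps of two orthonormal bases form a doubly stochastic matrix, which turns
   scalar inequalities on pairs of eigenvalues into trace inequalities. *)
Lemma tr_spm2_gap (phi psi : C -> C) (c : C) U P a b :
  U \is unitarymx -> P \is unitarymx ->
  \sum_i phi (a i) + \sum_j psi (b j) - c * \tr (spm U a *m spm P b) =
  \sum_i \sum_j (phi (a i) + psi (b j) - c * (a i * b j)) *
     `|(U^t* *m P) i j| ^+ 2.
Proof.
move=> uU uP; rewrite tr_spm2 /=.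
have uE : U^t* *m P \is unitarymx by rewrite mul_unitarymx ?trmxC_unitary.
move: (U^t* *m P) uE => E uE.
have -> : \sum_i phi (a i) = \sum_i \sum_j phi (a i) * `|E i j| ^+ 2.
  by apply: eq_bigr => i _; rewrite -mulr_sumr unitary_sum_row ?mulr1.
have -> : \sum_j psi (b j) = \sum_i \sum_j psi (b j) * `|E i j| ^+ 2.
  rewrite exchange_big; apply: eq_bigr => j _.
  by rewrite -mulr_sumr unitary_sum_col ?mulr1.
rewrite mulr_sumr -sumrN -!big_split; apply: eq_bigr => i _ /=.
rewrite mulr_sumr -sumrN -!big_split; apply: eq_bigr => j _ /=.
by rewrite mulrBl mulrDl mulrA.
Qed.

End Spectral.

(** * Positive matrices and parallel sums *)

Section Psd.
Variable C : numClosedFieldType.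
Variable n : nat.
Implicit Types (A M U P : 'M[C]_n) (a : 'I_n -> C).

Definition psdm M := M^t* = M /\
  forall v : 'cV[C]_n, 0 <= (v^t* *m M *m v) 0 0.

Definition posm M := M^t* = M /\
  forall v : 'cV[C]_n, v != 0 -> 0 < (v^t* *m M *m v) 0 0.

Lemma posm_psdm M : posm M -> psdm M.
Proof.
case=> h p; split=> // v; have [->|/p/ltW //] := eqVneq v 0.
by rewrite mulmx0 mxE.
Qed.

Lemma quad_col M (L : 'M[C]_n) j :
  ((col j L)^t* *m M *m col j L) 0 0 = (L^t* *m M *m L) j j.
Proof.
rewrite mxE [RHS]mxE; apply: eq_bigr => k _; rewrite mxE [(col _ _) _ _]mxE.
congr (_ * _); rewrite [RHS]mxE; apply: eq_bigr => l _.
by rewrite !adjE !mxE.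
Qed.

Lemma psdm_tr M (L : 'M[C]_n) : psdm M -> 0 <= \tr (L^t* *m M *m L).
Proof. by move=> [_ p]; rewrite sumr_ge0 // => j _; rewrite -quad_col. Qed.

Lemma spm_col U a j : U \is unitarymx ->
  ((col j U)^t* *m spm U a *m col j U) 0 0 = a j.
Proof.
move=> uU; rewrite quad_col /spm !mulmxA unitary_mulVmx // mul1mx.
by rewrite -(mulmxA (dg a)) unitary_mulVmx // mulmx1 !mxE eqxx mulr1n.
Qed.

Lemma psdm_spm_ge0 U a j : U \is unitarymx -> psdm (spm U a) -> 0 <= a j.
Proof. by move=> uU [_ /(_ (col j U))]; rewrite spm_col. Qed.

Lemma col_unitary_neq0 U j : U \is unitarymx -> col j U != 0.
Proof.
move=> uU; apply/eqP => h; have := unitary_sum_col j uU.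
rewrite big1 => [/eqP|i _]; first by rewrite eq_sym oner_eq0.
have /matrixP /(_ i 0) := h; rewrite !mxE => ->.
by rewrite normr0 expr0n.
Qed.

Lemma posm_spm_gt0 U a j : U \is unitarymx -> posm (spm U a) -> 0 < a j.
Proof.
by move=> uU [_ /(_ (col j U) (col_unitary_neq0 j uU))]; rewrite spm_col.
Qed.

Lemma unitarymx1 : (1%:M : 'M[C]_n) \is unitarymx.
Proof. by apply/unitarymxP; rewrite trmx1 map_mx1 mul1mx. Qed.

Lemma conj_diagE U M k : (U^t* *m M *m U) k k = ((col k U)^t* *m M *m col k U) 0 0.
Proof. by rewrite quad_col. Qed.

Lemma posm_diag U M k : U \is unitarymx -> posm M -> 0 < (U^t* *m M *m U) k k.
Proof. by move=> uU [_ p]; rewrite conj_diagE p // col_unitary_neq0. Qed.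

Lemma posm_diag1 M k : posm M -> 0 < M k k.
Proof.
move=> pM; have := posm_diag k unitarymx1 pM.
by rewrite trmx1 map_mx1 mul1mx mulmx1.
Qed.

Lemma psdm_diag U M k : psdm M -> 0 <= (U^t* *m M *m U) k k.
Proof. by move=> [_ p]; rewrite conj_diagE. Qed.

Lemma quad_spm U a (v : 'cV[C]_n) :
  (v^t* *m spm U a *m v) 0 0 = \sum_i a i * `|(U^t* *m v) i 0| ^+ 2.
Proof.
have -> : v^t* *m spm U a *m v = (U^t* *m v)^t* *m (dg a *m (U^t* *m v)).
  by rewrite /spm adjM trmxCK !mulmxA.
rewrite mxE; apply: eq_bigr => i _.
by rewrite adjE mul_diag_mx [X in _ * X]mxE !(mxE _ _ 0 i) normCKC mulrCA.
Qed.

Lemma spm_psdm U a : (forall i, 0 <= a i) -> psdm (spm U a).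
Proof.
move=> ha; split; first by apply: adj_spm => i; exact: ger0_real.
by move=> v; rewrite quad_spm sumr_ge0 // => i _; rewrite mulr_ge0 ?exprn_ge0.
Qed.

Lemma spm_posm U a : U \is unitarymx -> (forall i, 0 < a i) -> posm (spm U a).
Proof.
move=> uU ha; split; first by apply: adj_spm => i; exact: gtr0_real.
move=> v v0; rewrite quad_spm.
have ge0 i : 0 <= a i * `|(U^t* *m v) i 0| ^+ 2.
  by rewrite mulr_ge0 ?exprn_ge0 // ltW.
rewrite lt_def sumr_ge0 // andbT psumr_eq0 //; apply: contra v0 => /allP h.
have : U^t* *m v = 0.
  apply/matrixP => i j; rewrite ord1 [RHS]mxE; apply/eqP.
  have := h i (mem_index_enum i).
  by rewrite mulf_eq0 gt_eqF //= sqrf_eq0 normr_eq0.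
move=> /(congr1 (mulmx U)).
by rewrite mulmx0 mulmxA (unitarymxP uU) mul1mx => ->.
Qed.

Lemma posm_spectral M : posm M ->
  exists U a, [/\ U \is unitarymx, forall i, 0 < a i & M = spm U a].
Proof.
move=> pM; have [U [a [uU _ E]]] := hermitian_spectral (proj1 pM).
by exists U, a; split=> // i; apply: (posm_spm_gt0 i uU); rewrite -E.
Qed.

Lemma psdm_sqrt A : psdm A -> exists L : 'M[C]_n, L^t* = L /\ A = L *m L.
Proof.
move=> pA; have [U [a [uU _ E]]] := hermitian_spectral (proj1 pA).
have a0 i : 0 <= a i by apply: (psdm_spm_ge0 i uU); rewrite -E.
exists (spm U (fun i => sqrtC (a i))); rewrite spmM // E; split.
  by apply: adj_spm => i; rewrite ger0_real ?sqrtC_ge0.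
by apply: eq_spm => i; rewrite -expr2 sqrtCK.
Qed.

Lemma psdm_tr_mul A M : psdm A -> psdm M -> 0 <= \tr (A *m M).
Proof.
move=> /psdm_sqrt [L [hL ->]] pM.
by rewrite -mulmxA mxtrace_mulC -{1}hL psdm_tr.
Qed.

(* Operator convexity of [t |-> 1 / (t + s)]: the square completed for each [M x]
   is [((w x + s)^-1 - (W + s)^-1) M x ((w x + s)^-1 - (W + s)^-1)]. *)
Lemma resolvent_jensen (I : finType) (M : I -> 'M[C]_n) (w : I -> C)
    (U : 'M[C]_n) (om : 'I_n -> C) (rho : 'M[C]_n) (s : C) :
  U \is unitarymx -> (forall x, psdm (M x)) -> \sum_x M x = 1%:M ->
  \sum_x w x *: M x = spm U om -> psdm rho ->
  (forall x, 0 < w x) -> (forall k, 0 < om k) -> 0 < s ->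
  \sum_k (U^t* *m rho *m U) k k / (om k + s) <=
  \sum_x \tr (rho *m M x) / (w x + s).
Proof.
move=> uU pM M1 MW prho w0 om0 s0.
pose N := spm U (fun k => (om k + s)^-1).
have os0 k : 0 < om k + s by rewrite addr_gt0.
have ws0 x : 0 < w x + s by rewrite addr_gt0.
have -> : \sum_k (U^t* *m rho *m U) k k / (om k + s) = \tr (rho *m N).
  by rewrite tr_mul_spm; apply: eq_bigr => k _; rewrite mulrC.
have hN : N^t* = N by apply: adj_spm => k; rewrite gtr0_real // invr_gt0.
pose c x := (w x + s)^-1.
pose t1 x := \tr (rho *m M x); pose t2 x := \tr (rho *m N *m M x).
pose t3 x := \tr (rho *m M x *m N); pose t4 x := \tr (rho *m N *m M x *m N).
(* The expanded square [(w x + s) tr (rho D M x D)] with [D = c x - N]. *)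
have sq x : 0 <= c x * t1 x - t2 x - t3 x + (w x + s) * t4 x.
  have [L [hL rE]] := psdm_sqrt prho.
  pose D := (c x)%:M - N.
  have hD : D^t* = D.
    have -> : D = spm U (fun k => c x + -1 * (om k + s)^-1).
      by rewrite spmD spmZ spmC // scaleN1r.
    apply: adj_spm => k; rewrite mulN1r rpredB // gtr0_real // invr_gt0.
      exact: ws0.
    exact: os0.
  have -> : c x * t1 x - t2 x - t3 x + (w x + s) * t4 x =
      (w x + s) * \tr (rho *m D *m M x *m D).
    have cx : (w x + s) * c x = 1 by rewrite /c mulfV // gt_eqF.
    rewrite /D !(mulmxBr, mulmxBl) !mul_mx_scalar -!scalemxAl.
    rewrite !(raddfB, raddfD) /= !mxtraceZ -/(t1 x) -/(t2 x) -/(t3 x) -/(t4 x).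
    move: (w x + s) (c x) cx => u v cx.
    transitivity (u * v * (v * t1 x - t2 x - t3 x) + u * t4 x); last by ring.
    by rewrite cx mul1r.
  apply: mulr_ge0; first exact: ltW.
  have -> : \tr (rho *m D *m M x *m D) = \tr ((D *m L)^t* *m M x *m (D *m L)).
    by rewrite adjM hD hL rE -!mulmxA mxtrace_mulC !mulmxA.
  exact: psdm_tr.
(* The last three terms each sum to [tr (rho N)]: the [M x] sum to the identity, and
   [sum (w x + s) M x] is the inverse of [N]. *)
have S : \sum_x (c x * t1 x - t2 x - t3 x + (w x + s) * t4 x) =
    \sum_x c x * t1 x - \tr (rho *m N).
  rewrite big_split /= !sumrB.
  have -> : \sum_x t2 x = \tr (rho *m N).
    by rewrite -raddf_sum -mulmx_sumr M1 mulmx1.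
  have -> : \sum_x t3 x = \tr (rho *m N).
    by rewrite -raddf_sum -mulmx_suml -mulmx_sumr M1 mulmx1.
  have -> : \sum_x (w x + s) * t4 x = \tr (rho *m N).
    rewrite /t4; under eq_bigr do rewrite -mxtraceZ scalemxAl scalemxAr.
    rewrite -raddf_sum -mulmx_suml -mulmx_sumr.
    have -> : \sum_x (w x + s) *: M x = spm U (fun k => om k + s).
      under eq_bigr do rewrite scalerDl.
      by rewrite big_split /= MW -scaler_sumr M1 spmD spmC // scalemx1.
    rewrite -[_ *m N *m _]mulmxA -mulmxA !spmM //=; congr (\tr (_ *m _)).
    by apply: eq_spm => k /=; rewrite mulVf ?mul1r // gt_eqF.
  by rewrite subrK.
rewrite -subr_ge0.
under eq_bigr => x _ do rewrite mulrC -/(c x) -/(t1 x).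
by rewrite -S sumr_ge0.
Qed.

(* With [G = P^* diag(g) R] and [H = P^* diag(f) R], this is the parallel sum formula
   [a b / (a + b) |z|^2 = min_(z = g + h) a |g|^2 + b |h|^2] applied entrywise to the
   decomposition [P^* diag(k) R = G + H]; [g] and [f] are the best diagonal choices. *)
Lemma parallel_sum_gap P R a (y k a' y' : 'I_n -> C) (s : C) :
  P \is unitarymx -> R \is unitarymx ->
  (forall i, 0 < a i) -> (forall j, 0 < y j) -> (forall i, 0 < k i) -> 0 < s ->
  (forall i, a' i = spm P a i i) -> (forall i, y' i = spm R y i i) ->
  let g i := k i * (s * y' i) / (a' i + s * y' i) in
  let f i := k i * a' i / (a' i + s * y' i) in
  s * (\sum_i k i ^+ 2 * (a' i * y' i / (a' i + s * y' i)) -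
    \sum_i \sum_j `|(P^t* *m dg k *m R) i j| ^+ 2 * (a i * y j / (a i + s * y j))) =
  \sum_i \sum_j `|a i * (P^t* *m dg g *m R) i j -
     s * y j * (P^t* *m dg f *m R) i j| ^+ 2 / (a i + s * y j).
Proof.
move=> uP uR a0 y0 k0 s0 Ea Ey g f.
have a'0 i : 0 < a' i by rewrite Ea; apply/posm_diag1/spm_posm.
have y'0 i : 0 < y' i by rewrite Ey; apply/posm_diag1/spm_posm.
have den i : a' i + s * y' i != 0 by rewrite gt_eqF // addr_gt0 // mulr_gt0.
have rg i : g i \is Num.real.
  by rewrite gtr0_real // divr_gt0 ?addr_gt0 ?mulr_gt0.
have rf i : f i \is Num.real.
  by rewrite gtr0_real // divr_gt0 ?addr_gt0 ?mulr_gt0.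
(* The weight depends on the row only, so unitarity of [R] removes it and the diagonal of [spm P a]
   remains. [EH] is the mirror image. *)
have EG : \sum_i \sum_j a i * `|(P^t* *m dg g *m R) i j| ^+ 2 =
    \sum_i g i ^+ 2 * a' i.
  transitivity (\tr (dg (fun i => g i * g i) *m spm P a)); last first.
    by apply: eq_bigr => i _; rewrite dg_mulE Ea expr2.
  transitivity (\tr (dg a *m (P^t* *m dg g *m R) *m dg (fun=> 1) *m
      (P^t* *m dg g *m R)^t* )).
    rewrite tr_dg_quad; apply: eq_bigr => i _; apply: eq_bigr => j _.
    by rewrite mulr1.
  rewrite dgC mulmx1 !adjM adj_dg // trmxCK -dgM /spm.
  rewrite !mulmxA -(mulmxA _ R) (unitarymxP uR) mulmx1.
  by rewrite -!mulmxA (mulmxA (dg a)) mxtrace_mulC !mulmxA.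
have EH : \sum_i \sum_j y j * `|(P^t* *m dg f *m R) i j| ^+ 2 =
    \sum_i f i ^+ 2 * y' i.
  transitivity (\tr (dg (fun i => f i * f i) *m spm R y)); last first.
    by apply: eq_bigr => i _; rewrite dg_mulE Ey expr2.
  transitivity (\tr (dg (fun=> 1) *m (P^t* *m dg f *m R) *m dg y *m
      (P^t* *m dg f *m R)^t* )).
    rewrite tr_dg_quad; apply: eq_bigr => i _; apply: eq_bigr => j _.
    by rewrite mul1r.
  rewrite dgC mul1mx !adjM adj_dg // trmxCK -dgM /spm.
  rewrite !mulmxA mxtrace_mulC !mulmxA (unitarymxP uP) mul1mx.
  by rewrite mxtrace_mulC !mulmxA.
have kE i j : (P^t* *m dg k *m R) i j =
    (P^t* *m dg g *m R) i j + (P^t* *m dg f *m R) i j.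
  have -> : dg k = dg g + dg f.
    rewrite -dgD; apply: eq_dg => p; rewrite /g /f; field; exact: den.
  by rewrite mulmxDr mulmxDl mxE.
rewrite mulrBr.
have -> : s * (\sum_i k i ^+ 2 * (a' i * y' i / (a' i + s * y' i))) =
    \sum_i g i ^+ 2 * a' i + s * \sum_i f i ^+ 2 * y' i.
  rewrite !mulr_sumr -big_split; apply: eq_bigr => i _ /=; rewrite /g /f.
  field; exact: den.
rewrite -EG -EH !mulr_sumr -sumrN -!big_split; apply: eq_bigr => i _ /=.
rewrite !mulr_sumr -sumrN -!big_split; apply: eq_bigr => j _ /=.
have d : a i + s * y j != 0 by rewrite gt_eqF // addr_gt0 // mulr_gt0.
have ca : (a i)^* = a i by rewrite conj_Creal // gtr0_real.
have cs : s^* = s by rewrite conj_Creal // gtr0_real.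
have cy : (y j)^* = y j by rewrite conj_Creal // gtr0_real.
rewrite kE; move: ((_ *m dg g *m _) i j) ((_ *m dg f *m _) i j) => z1 z2.
rewrite !normCK rmorphB rmorphD !rmorphM /= ca cs cy.
field; exact: d.
Qed.

Lemma parallel_sum_ge0 P R a (y k a' y' : 'I_n -> C) (s : C) :
  P \is unitarymx -> R \is unitarymx ->
  (forall i, 0 < a i) -> (forall j, 0 < y j) -> (forall i, 0 < k i) -> 0 < s ->
  (forall i, a' i = spm P a i i) -> (forall i, y' i = spm R y i i) ->
  0 <= \sum_i k i ^+ 2 * (a' i * y' i / (a' i + s * y' i)) -
    \sum_i \sum_j `|(P^t* *m dg k *m R) i j| ^+ 2 * (a i * y j / (a i + s * y j)).
Proof.
move=> uP uR a0 y0 k0 s0 Ea Ey; rewrite -(pmulr_rge0 _ s0).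
rewrite (parallel_sum_gap uP uR a0 y0 k0 s0 Ea Ey).
apply: sumr_ge0 => i _; apply: sumr_ge0 => j _.
by rewrite divr_ge0 ?exprn_ge0 // addr_ge0 ?mulr_ge0 // ltW.
Qed.

(** A zero gap kills each square, that is [diag(a) G = H diag(s y)]; undoing [P] and [R] relates
    [spm P a] to [spm R y]. Clearing denominators makes both sides affine in [s]. *)
Lemma parallel_sum_eq P R a (y k a' y' : 'I_n -> C) (s : C) :
  P \is unitarymx -> R \is unitarymx ->
  (forall i, 0 < a i) -> (forall j, 0 < y j) -> (forall i, 0 < k i) -> 0 < s ->
  (forall i, a' i = spm P a i i) -> (forall i, y' i = spm R y i i) ->
  \sum_i k i ^+ 2 * (a' i * y' i / (a' i + s * y' i)) -
    \sum_i \sum_j `|(P^t* *m dg k *m R) i j| ^+ 2 * (a i * y j / (a i + s * y j)) = 0 ->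
  forall p q, k q * y' q * (a' p + s * y' p) * spm P a p q =
              k p * a' p * (a' q + s * y' q) * spm R y p q.
Proof.
move=> uP uR a0 y0 k0 s0 Ea Ey E p q.
have a'0 i : 0 < a' i by rewrite Ea; apply/posm_diag1/spm_posm.
have y'0 i : 0 < y' i by rewrite Ey; apply/posm_diag1/spm_posm.
have := parallel_sum_gap uP uR a0 y0 k0 s0 Ea Ey; rewrite E mulr0 => /esym.
set g := fun i => k i * (s * y' i) / _; set f := fun i => k i * a' i / _.
have den i j : 0 < a i + s * y j by rewrite addr_gt0 // mulr_gt0.
have nn i j : 0 <= `|a i * (P^t* *m dg g *m R) i j -
     s * y j * (P^t* *m dg f *m R) i j| ^+ 2 / (a i + s * y j).
  by rewrite divr_ge0 ?exprn_ge0 // ltW.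
move=> /eqP; rewrite psumr_eq0 => [/allP H|i _]; last exact: sumr_ge0.
have eqm : dg a *m (P^t* *m dg g *m R) = (P^t* *m dg f *m R) *m dg (fun j => s * y j).
  apply/matrixP => i j; rewrite dg_mulE mul_dgE [RHS]mulrC.
  apply/eqP; rewrite -subr_eq0 -normr_eq0 -sqrf_eq0.
  have := H i (mem_index_enum i).
  rewrite /= psumr_eq0 // => /allP /(_ j (mem_index_enum j)).
  by rewrite /= mulf_eq0 invr_eq0 (gt_eqF (den i j)) orbF.
have : spm P a *m dg g = dg f *m spm R (fun j => s * y j).
  have := congr1 (fun X => P *m X *m R^t* ) eqm; rewrite /= /spm !mulmxA.
  rewrite (unitarymxP uP) mul1mx => <-.
  by rewrite -(mulmxA _ R) (unitarymxP uR) mulmx1.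
have scE (M : 'M[C]_n) : (s *: M) p q = s * M p q by rewrite mxE.
rewrite spmZ => /matrixP /(_ p q); rewrite mul_dgE dg_mulE scE.
have d i : a' i + s * y' i != 0 by rewrite gt_eqF // addr_gt0 // mulr_gt0.
have sn : s != 0 by rewrite gt_eqF.
have -> : k q * y' q * (a' p + s * y' p) =
    g q * ((a' q + s * y' q) * (a' p + s * y' p) / s).
  by rewrite /g; field; rewrite d sn.
have -> : k p * a' p * (a' q + s * y' q) =
    f p * s * ((a' q + s * y' q) * (a' p + s * y' p) / s).
  by rewrite /f; field; rewrite d sn.
move: ((a' q + s * y' q) * (a' p + s * y' p) / s) => z h.
transitivity (z * (spm P a p q * g q)); first by ring.
by rewrite h; ring.
Qed.

(* Equality for two values of [s] separates the two sides of [parallel_sum_eq]. *)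
Lemma parallel_sum_eq_commute P R a (y k a' y' : 'I_n -> C) :
  P \is unitarymx -> R \is unitarymx ->
  (forall i, 0 < a i) -> (forall j, 0 < y j) -> (forall i, 0 < k i) ->
  (forall i, a' i = spm P a i i) -> (forall i, y' i = spm R y i i) ->
  (forall s, s \in [:: 1; 2] ->
    \sum_i k i ^+ 2 * (a' i * y' i / (a' i + s * y' i)) -
    \sum_i \sum_j `|(P^t* *m dg k *m R) i j| ^+ 2 * (a i * y j / (a i + s * y j)) = 0) ->
  forall p q, spm P a p q != 0 -> k p = k q.
Proof.
move=> uP uR a0 y0 k0 Ea Ey E p q Apq.
have a'0 i : 0 < a' i by rewrite Ea; apply/posm_diag1/spm_posm.
have y'0 i : 0 < y' i by rewrite Ey; apply/posm_diag1/spm_posm.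
have E1 := E 1 (mem_head _ _); have E2 := E 2 (mem_last 1 [:: 2]).
have H1 := parallel_sum_eq uP uR a0 y0 k0 ltr01 Ea Ey E1.
have H2 := parallel_sum_eq uP uR a0 y0 k0 (ltr0Sn _ 1) Ea Ey E2.
have e1 := H1 p q; have e2 := H2 p q; have f1 := H1 q p; have f2 := H2 q p.
have swap (U : 'M[C]_n) b : (forall i, 0 < b i) -> spm U b q p = (spm U b p q)^*.
  by move=> b0; rewrite -adjE adj_spm // => i; rewrite gtr0_real.
(* The coefficient of [s]: the case [s = 2] minus the case [s = 1]. *)
have g1 : k q * y' p * spm P a p q = k p * a' p * spm R y p q.
  apply: (mulfI (lt0r_neq0 (y'0 q))).
  transitivity (k q * y' q * (a' p + 2 * y' p) * spm P a p q -
     k q * y' q * (a' p + 1 * y' p) * spm P a p q); first by ring.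
  by rewrite e1 e2; ring.
(* The constant term: twice the case [s = 1] minus the case [s = 2], with [p] and [q] exchanged and
   then conjugated. *)
have g2 : k p * y' p * spm P a p q = k q * a' p * spm R y p q.
  have : k p * y' p * spm P a q p = k q * a' p * spm R y q p.
    apply: (mulfI (lt0r_neq0 (a'0 q))).
    transitivity (k p * y' p * (a' q + 1 * y' q) * spm P a q p *+ 2 -
       k p * y' p * (a' q + 2 * y' q) * spm P a q p); first by ring.
    by rewrite f1 f2; ring.
  rewrite !swap // => /(congr1 Num.conj); rewrite !rmorphM /= !conjCK.
  by rewrite !conj_Creal // gtr0_real.
have Ypq : spm R y p q != 0.
  apply/eqP => h; move: g1; rewrite h mulr0 => /eqP.
  by rewrite mulf_eq0 (negPf Apq) orbF gt_eqF // mulr_gt0.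
have h : k p ^+ 2 = k q ^+ 2.
  apply: (mulIf (mulf_neq0 (lt0r_neq0 (mulr_gt0 (y'0 p) (a'0 p)))
    (mulf_neq0 Apq Ypq))).
  transitivity ((k p * y' p * spm P a p q) * (k p * a' p * spm R y p q)).
    by ring.
  by rewrite g2 -g1; ring.
by apply/eqP; rewrite -(eqrXn2 (_ : 0 < 2)%N) ?ltW // h.
Qed.

(** With [A = spm P a] the double sum is the trace of [k A k] against [spm R b], and [R]
    diagonalizes [k A k]. This evaluates the double sum once the parallel sums have been
    integrated. *)
Lemma overlap_trace P R a (b k kap : 'I_n -> C) :
  P \is unitarymx -> R \is unitarymx -> (forall i, 0 < k i) ->
  dg k *m spm P a *m dg k = spm R kap ->
  \sum_i \sum_j a i * b j * `|(P^t* *m dg k *m R) i j| ^+ 2 = \sum_j kap j * b j.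
Proof.
move=> uP uR k0 Z; rewrite -tr_dg_quad !adjM trmxCK adj_dg; last first.
  by move=> i; rewrite gtr0_real.
rewrite -(tr_spm _ uR) -spmM // -Z /spm !mulmxA.
by rewrite mxtrace_mulC !mulmxA mxtrace_mulC !mulmxA.
Qed.

End Psd.

(** * Real powers and trace inequalities *)

Local Arguments Rpower (_ _)%_ring_scope.

Lemma wsum_bigop (I : eqType) (s : seq I) (c t : I -> R) (g : R -> R) :
  wsum g (map (fun i => (c i, t i)) s) = \sum_(i <- s) c i * g (t i).
Proof.
elim: s => [|i s IH]; first by rewrite big_nil.
by rewrite big_cons -IH.
Qed.

Lemma mem_In (T : eqType) (s : seq T) (x : T) : x \in s -> List.In x s.
Proof.
elim: s => //= y s IH; rewrite in_cons => /orP[/eqP ->|/IH]; by [left | right].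
Qed.

Lemma resolvent_power (I : finType) (c t : I -> R) (th : R) :
  0 < th -> th < 1 -> (forall i, 0 < t i) ->
  (forall s, 0 < s -> 0 <= \sum_i c i / (t i + s)) ->
  0 <= \sum_i c i * Rpower (t i) (- th) /\
  (\sum_i c i * Rpower (t i) (- th) = 0 ->
   forall s, 0 < s -> \sum_i c i / (t i + s) = 0).
Proof.
move=> /RltP th0 /RltP th1 t0 H.
have E g := wsum_bigop (index_enum I) c t g.
have [||h1 h2] := @wsum_resolvent_power th
  (map (fun i => (c i, t i)) (index_enum I)) (conj th0 th1).
- by move=> p /in_map_iff [i [<- _]]; apply/RltP; exact: t0.
- by move=> s /RltP s0; apply/RleP; rewrite (E (fun t => Rinv (t + s))); exact: H.
- split; first by apply/RleP; rewrite -(E (fun t => Rpower t (- th))).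
  rewrite -(E (fun t => Rpower t (- th))) => h s /RltP s0.
  by rewrite -(E (fun t => Rinv (t + s))); exact: h2.
Qed.

Lemma rpow_gt0 (x s : R) : 0 < Rpower x s.
Proof. by apply/RltP; exact: exp_pos. Qed.

Lemma rpowD (x s t : R) : Rpower x (s + t) = Rpower x s * Rpower x t.
Proof. exact: Rpower_plus. Qed.

Lemma rpowM (x s t : R) : Rpower (Rpower x s) t = Rpower x (s * t).
Proof. exact: Rpower_mult. Qed.

Lemma rpow1 (x : R) : 0 < x -> Rpower x 1 = x.
Proof. by move=> /RltP; exact: Rpower_1. Qed.

Lemma rpow0 (x : R) : 0 < x -> Rpower x 0 = 1.
Proof. by move=> /RltP; exact: Rpower_O. Qed.

Lemma rpowN (x s : R) : Rpower x (- s) = (Rpower x s)^-1.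
Proof. exact: Rpower_Ropp. Qed.

Lemma rpow_mull (x y s : R) : 0 < x -> 0 < y ->
  Rpower (x * y) s = Rpower x s * Rpower y s.
Proof. by move=> /RltP x0 /RltP y0; exact: esym (Rpower_mult_distr _ _ _ x0 y0). Qed.

Lemma rpow_invl (x s : R) : 0 < x -> Rpower x^-1 s = Rpower x (- s).
Proof.
by move=> x0; rewrite -{1}(rpow1 x0) -rpowN rpowM mulN1r.
Qed.

Lemma rpow_inj (x y s : R) : 0 < x -> 0 < y -> s != 0 ->
  Rpower x s = Rpower y s -> x = y.
Proof.
move=> x0 y0 s0 h; rewrite -(rpow1 x0) -(rpow1 y0) -(mulfV s0).
by rewrite -!rpowM h.
Qed.

Lemma young_pow (u v g : R) : 0 < u -> 0 < v -> 0 < g -> g < 1 ->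
  Rpower u g * Rpower v (1 - g) <= g * u + (1 - g) * v.
Proof.
move=> /RltP u0 /RltP v0 /RltP g0 /RltP g1; apply/RleP.
exact: (proj1 (Rpower_young u v g u0 v0 (conj g0 g1))).
Qed.

Lemma young_pow_eq (u v g : R) : 0 < u -> 0 < v -> 0 < g -> g < 1 ->
  Rpower u g * Rpower v (1 - g) = g * u + (1 - g) * v -> u = v.
Proof.
move=> /RltP u0 /RltP v0 /RltP g0 /RltP g1.
exact: (proj2 (Rpower_young u v g u0 v0 (conj g0 g1))).
Qed.

(** A parallel sum is a resolvent at the ratio, [u v / (u + s v) = v (u/v) / (u/v + s)]; integrated
    with exponent [1 - g] it becomes the geometric mean on the right. *)
Lemma ratio_pow (u v g : R) : 0 < u -> 0 < v ->
  v * (u / v) * Rpower (u / v) (- (1 - g)) = Rpower u g * Rpower v (1 - g).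
Proof.
move=> u0 v0; have uv0 : 0 < u / v by rewrite divr_gt0.
rewrite -mulrA -{1}(rpow1 uv0) -rpowD opprB addrCA subrr addr0.
rewrite rpow_mull ?invr_gt0 // mulrCA rpow_invl //; congr (_ * _).
by rewrite -{1}(rpow1 v0) -rpowD.
Qed.

(** For [al < 1] Young is applied to [x y] and [v = y^(al/(al-1))] with weight [al]; for [al > 1] to
    [x^al] and [v] with weight [1/al]. The factor [al - 1] absorbs the change of direction. *)
Lemma young_renyi (al x y : R) : 0 < al -> al != 1 -> 0 < x -> 0 < y ->
  0 <= (al - 1) * (Rpower x al + (al - 1) * Rpower y (al / (al - 1)) - al * (x * y)) /\
  ((al - 1) * (Rpower x al + (al - 1) * Rpower y (al / (al - 1)) - al * (x * y)) = 0 ->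
   x = Rpower y (al - 1)^-1).
Proof.
move=> al0 al1 x0 y0.
have aln0 : al != 0 by rewrite gt_eqF.
have d0 : al - 1 != 0 by rewrite subr_eq0.
pose v := Rpower y (al / (al - 1)); have v0 : 0 < v by exact: rpow_gt0.
have fin : x * y = v -> x = Rpower y (al - 1)^-1.
  move=> h; apply: (mulIf (lt0r_neq0 y0)); rewrite h /v -{3}(rpow1 y0) -rpowD.
  by congr Rpower; field.
have [lt1|gt1|e] := ltgtP al 1; last by rewrite e eqxx in al1.
- have u0 : 0 < x * y by rewrite mulr_gt0.
  have E : Rpower (x * y) al * Rpower v (1 - al) = Rpower x al.
    rewrite rpow_mull // -mulrA /v rpowM -rpowD -[RHS]mulr1; congr (_ * _).
    rewrite (_ : al + _ = 0) ?rpow0 //; by field.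
  have g := young_pow u0 v0 al0 lt1; have ge := young_pow_eq u0 v0 al0 lt1.
  rewrite E in g ge; split.
    rewrite nmulr_rge0 ?subr_lt0 // -subr_ge0 sub0r; move: g; rewrite -subr_ge0.
    by congr (_ <= _); rewrite -/v; ring.
  move=> /eqP; rewrite mulf_eq0 (negPf d0) /= => /eqP h; apply/fin/ge.
  by apply/eqP; rewrite -subr_eq0 -[X in _ == X]h; apply/eqP; rewrite -/v; ring.
- have i0 : 0 < al^-1 by rewrite invr_gt0.
  have i1 : al^-1 < 1 by rewrite invf_lt1.
  pose u := Rpower x al; have u0 : 0 < u by exact: rpow_gt0.
  have E : Rpower u al^-1 * Rpower v (1 - al^-1) = x * y.
    rewrite /u /v !rpowM mulfV // rpow1 //; congr (_ * _).
    rewrite (_ : _ * _ = 1) ?rpow1 //; field; by rewrite aln0 d0.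
  have g := young_pow u0 v0 i0 i1; have ge := young_pow_eq u0 v0 i0 i1.
  rewrite E in g ge; rewrite -/u -/v.
  have e : u + (al - 1) * v - al * (x * y) =
      al * (al^-1 * u + (1 - al^-1) * v - x * y) by field.
  rewrite e; split.
    by rewrite pmulr_rge0 ?subr_gt0 // pmulr_rge0 // subr_ge0.
  move=> /eqP; rewrite !mulf_eq0 (negPf d0) (negPf aln0) /= subr_eq0 => /eqP h.
  have uv := ge (esym h); apply: (@rpow_inj _ _ al) => //; first exact: rpow_gt0.
  by rewrite -/u uv /v rpowM mulrC.
Qed.

Fact rspm_key : unit. Proof. exact: tt. Qed.

(* [K] is kept abstract: unification on matrices over the concrete [complex R] is
   prohibitively slow. *)
Section Embedding.
Variables (K : numClosedFieldType) (rc : {rmorphism R -> K}) (rp : K -> R).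
Hypothesis rc_le : forall x y : R, (rc x <= rc y) = (x <= y).
Hypothesis rpK : forall z : K, z \is Num.real -> rc (rp z) = z.

Lemma rc_inj : injective rc.
Proof. exact: fmorph_inj. Qed.

Lemma rc_lt (x y : R) : (rc x < rc y) = (x < y).
Proof. by rewrite !lt_neqAle rc_le (inj_eq rc_inj). Qed.

Lemma rc_gt0 (x : R) : (0 < rc x) = (0 < x).
Proof. by rewrite -rc_lt rmorph0. Qed.

Lemma rc_ge0 (x : R) : (0 <= rc x) = (0 <= x).
Proof. by rewrite -rc_le rmorph0. Qed.

Lemma rc_real (x : R) : rc x \is Num.real.
Proof.
have /orP[x0|x0] := le_total 0 x; first by rewrite ger0_real ?rc_ge0.
by rewrite ler0_real // -(rmorph0 rc) rc_le.
Qed.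

Lemma rcK : cancel rc rp.
Proof. by move=> x; apply: rc_inj; rewrite rpK ?rc_real. Qed.

Lemma rcM (x y : R) : rc (x * y) = rc x * rc y.
Proof. exact: rmorphM. Qed.

Lemma rc_sum (I : finType) (f : I -> R) : rc (\sum_i f i) = \sum_i rc (f i).
Proof. exact: rmorph_sum. Qed.

Variable n : nat.

(* Here [k = b^(g/2)], [y = kap^(1/g)], and [t ^ g] is integrated over the
   parallel sums of [parallel_sum_ge0]; the scalar Young inequality finishes. *)
Lemma araki_lieb_thirring (P S : 'M[K]_n) (a b kap a' : 'I_n -> R) (g : R) :
  P \is unitarymx -> S \is unitarymx -> (forall i, 0 < a i) ->
  (forall i, 0 < b i) -> (forall i, 0 < kap i) -> 0 < g -> g < 1 ->
  (forall i, rc (a' i) = spm P (fun i => rc (a i)) i i) ->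
  dg (fun i => (rc (Rpower (b i) (g / 2)))) *m spm P (fun i => (rc (Rpower (a i) g))) *m
    dg (fun i => (rc (Rpower (b i) (g / 2)))) = spm S (fun i => rc (kap i)) ->
  \sum_j Rpower (kap j) g^-1 <= \sum_k b k * a' k /\
  (\sum_j Rpower (kap j) g^-1 = \sum_k b k * a' k ->
   forall p q, spm P (fun i => rc (a i)) p q != 0 -> b p = b q).
Proof.
move=> uP uS a0 b0 kap0 g0 g1 Ea Z.
pose y j := Rpower (kap j) g^-1; pose k i := Rpower (b i) (g / 2).
have y0 j : 0 < y j by exact: rpow_gt0.
have k0 j : 0 < k j by exact: rpow_gt0.
have a0C i : 0 < rc (a i) by rewrite rc_gt0.
have y0C i : 0 < rc (y i) by rewrite rc_gt0.
have k0C i : 0 < rc (k i) by rewrite rc_gt0.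
have [y' y'E] : exists y' : 'I_n -> R, forall i,
    0 < y' i /\ rc (y' i) = spm S (fun j => rc (y j)) i i.
  exists (fun i => rp (spm S (fun j => rc (y j)) i i)) => i.
  have p : 0 < spm S (fun j => rc (y j)) i i by apply/posm_diag1/spm_posm.
  by rewrite -rc_gt0 rpK // gtr0_real.
have y'0 i := proj1 (y'E i); have Ey i := proj2 (y'E i).
have a'0 i : 0 < a' i by rewrite -rc_gt0 Ea; apply/posm_diag1/spm_posm.
have gn0 : g != 0 by rewrite gt_eqF.
have Ey' : \sum_i y' i = \sum_j y j.
  apply: rc_inj; rewrite !rc_sum -[RHS](tr_spm _ uS).
  by apply: eq_bigr => i _; exact: Ey.
(* The left summand indexes the positive terms of the parallel-sum gap, the pairs its negative
   terms; [t] and [c] below write each term as a resolvent at a ratio. *)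
pose I := ('I_n + 'I_n * 'I_n)%type.
have [m mE] : exists m : 'I_n -> 'I_n -> R, forall i j,
    rc (m i j) = `|(P^t* *m dg (fun i => rc (k i)) *m S) i j| ^+ 2.
  exists (fun i j => rp (`|(P^t* *m dg (fun i => rc (k i)) *m S) i j| ^+ 2)).
  by move=> i j; rewrite rpK // ger0_real // exprn_ge0.
pose t (x : I) := match x with inl i => a' i / y' i | inr ij => a ij.1 / y ij.2 end.
pose c (x : I) := match x with inl i => k i ^+ 2 * y' i * (a' i / y' i)
   | inr ij => - (m ij.1 ij.2 * y ij.2 * (a ij.1 / y ij.2)) end.
have t0 x : 0 < t x by case: x => [i|[i j]] /=; rewrite divr_gt0.
have cE s : 0 < s -> \sum_x c x / (t x + s) =
    \sum_i k i ^+ 2 * (a' i * y' i / (a' i + s * y' i)) -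
    \sum_i \sum_j m i j * (a i * y j / (a i + s * y j)).
  move=> s0; rewrite big_sumType /= pair_big -sumrN /=.
  have fr (l u v : R) : 0 < u -> 0 < v ->
      l * v * (u / v) / (u / v + s) = l * (u * v / (u + s * v)).
    move=> u0 v0; have d : u + s * v != 0 by rewrite gt_eqF // addr_gt0 // mulr_gt0.
    by field; rewrite d gt_eqF.
  by congr (_ + _); apply: eq_bigr => i _; rewrite ?mulNr fr.
have cEC s : 0 < s -> (rc (\sum_x c x / (t x + s))) =
    \sum_i rc (k i) ^+ 2 * (rc (a' i) * rc (y' i) / (rc (a' i) + rc s * rc (y' i))) -
    \sum_i \sum_j `|(P^t* *m dg (fun i => rc (k i)) *m S) i j| ^+ 2 *
       (rc (a i) * rc (y j) / (rc (a i) + rc s * rc (y j))).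
  move=> s0; rewrite cE // rmorphB !rmorph_sum; congr (_ - _); apply: eq_bigr => i _.
    by rewrite rmorphM rmorphXn !rmorphM fmorphV rmorphD rmorphM.
  rewrite rmorph_sum; apply: eq_bigr => j _.
  by rewrite !rmorphM mE fmorphV rmorphD rmorphM.
have g'0 : 0 < 1 - g by rewrite subr_gt0.
have g'1 : 1 - g < 1 by rewrite gtrBl.
have [|h1 h2] := resolvent_power g'0 g'1 t0 (c := c).
  move=> s s0; rewrite -rc_ge0 cEC //.
  by apply: (parallel_sum_ge0 uP uS a0C y0C k0C _ Ea Ey); rewrite rc_gt0.
(* Integration turns each parallel sum into a geometric mean; by [overlap_trace] the double sum
   collapses to [sum kap y^(1-g)], which is [sum y] since [y = kap^(1/g)]. *)
have cP : \sum_x c x * Rpower (t x) (- (1 - g)) =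
    \sum_i Rpower (b i * a' i) g * Rpower (y' i) (1 - g) - \sum_j y j.
  rewrite big_sumType /=; congr (_ + _).
    apply: eq_bigr => i _; rewrite -2!(mulrA (k i ^+ 2)) ratio_pow //.
    rewrite rpow_mull // mulrA; congr (_ * _ * _).
    by rewrite /k expr2 -rpowD -splitr.
  under eq_bigr => x _ do rewrite mulNr -2!(mulrA (m _ _)) ratio_pow //.
  rewrite sumrN; congr (- _).
  rewrite -(pair_big predT predT (fun i j => m i j *
    (Rpower (a i) g * Rpower (y j) (1 - g)))) /=.
  apply: rc_inj.
  transitivity (\sum_j rc (kap j) * (rc (Rpower (y j) (1 - g)))).
    rewrite -(overlap_trace _ uP uS k0C Z) rmorph_sum; apply: eq_bigr => i _.
    rewrite rmorph_sum; apply: eq_bigr => j _.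
    by rewrite rmorphM /= mE rmorphM mulrC.
  rewrite rc_sum; apply: eq_bigr => j _; rewrite -rmorphM; congr (rc _).
  rewrite /y rpowM -{1}(rpow1 (kap0 j)) -rpowD; congr Rpower.
  by rewrite mulrBr mulr1 mulVf // addrC subrK.
rewrite cP subr_ge0 in h1; rewrite cP in h2.
have Y i : Rpower (b i * a' i) g * Rpower (y' i) (1 - g) <=
    g * (b i * a' i) + (1 - g) * y' i.
  by apply: young_pow => //; rewrite mulr_gt0.
(* With [h1] and [sum y' = sum y] this reads [S <= g T + (1 - g) S], that is [S <= T]. *)
have YS : \sum_i Rpower (b i * a' i) g * Rpower (y' i) (1 - g) <=
    g * (\sum_i b i * a' i) + (1 - g) * \sum_j y j.
  by rewrite -Ey' !mulr_sumr -big_split ler_sum.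
have le1 := le_trans h1 YS.
split.
  rewrite -(ler_pM2l g0) -subr_ge0; move: le1; rewrite -subr_ge0.
  by congr (_ <= _); rewrite -/y; ring.
move=> E p q; have {}E : \sum_j y j = \sum_i b i * a' i by [].
move=> Apq; apply: (@rpow_inj _ _ (g / 2)%R) => //.
  by rewrite mulf_neq0 // invr_eq0 pnatr_eq0.
apply: rc_inj.
apply: (parallel_sum_eq_commute uP uS a0C y0C k0C Ea Ey) Apq => s.
(* Equality leaves no room in the integrated inequality, so by [h2] the parallel-sum gap vanishes
   for every [s]. *)
have z : \sum_x c x * Rpower (t x) (- (1 - g)) = 0.
  rewrite cP; apply/eqP; rewrite subr_eq0 eq_le h1 andbT.
  by apply: (le_trans YS); rewrite -E -mulrDl addrC subrK mul1r.
rewrite cP in z.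
rewrite !inE => /orP[] /eqP ->.
  by have := cEC 1 ltr01; rewrite (h2 z) // rmorph1 rmorph0 => <-.
by have := cEC 2 (ltr0Sn _ 1); rewrite (h2 z) // rmorph_nat rmorph0 => <-.
Qed.

(** * Spectral matrices with real eigenvalues and the bound on [Psi] *)

Implicit Types (U P S V : 'M[K]_n).

(* Locked, since [mulmxA] would otherwise reassociate the product hidden in [spm]. *)
Definition rspm U (a : 'I_n -> R) : 'M[K]_n :=
  locked_with rspm_key (spm U (fun i => rc (a i))).

Lemma rspmE U a : rspm U a = spm U (fun i => rc (a i)).
Proof. by rewrite /rspm unlock. Qed.

Lemma rspmM U a b : U \is unitarymx ->
  rspm U a *m rspm U b = rspm U (fun i => a i * b i).
Proof. by move=> uU; rewrite !rspmE (spmM _ _ uU); apply: eq_spm => i; rewrite rcM. Qed.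

Lemma eq_rspm U a b : a =1 b -> rspm U a = rspm U b.
Proof. by move=> h; rewrite !rspmE; apply: eq_spm => i; rewrite h. Qed.

Lemma rspm1 U : U \is unitarymx -> rspm U (fun=> 1) = 1%:M.
Proof. by move=> uU; rewrite rspmE rmorph1 spmC. Qed.

Lemma adj_rspm U a : (rspm U a)^t* = rspm U a.
Proof. by rewrite rspmE; apply: adj_spm => i; exact: rc_real. Qed.

Lemma rspm_posm U a : U \is unitarymx -> (forall i, 0 < a i) -> posm (rspm U a).
Proof. by move=> uU a0; rewrite rspmE; apply: spm_posm => // i; rewrite rc_gt0. Qed.

Lemma commute_rspm_fun (f : R -> R) M U a : U \is unitarymx ->
  M *m rspm U a = rspm U a *m M -> M *m rspm U (f \o a) = rspm U (f \o a) *m M.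
Proof.
move=> uU; rewrite !rspmE => /(commute_spm_fun (fun z => rc (f (rp z))) uU).
by rewrite (@eq_spm _ _ _ _ (fun i => rc (f (a i)))) => [//|i /=]; rewrite rcK.
Qed.

Lemma rspm_fun (f : R -> R) U P a b : U \is unitarymx -> P \is unitarymx ->
  rspm U a = rspm P b -> rspm U (f \o a) = rspm P (f \o b).
Proof.
move=> uU uP; rewrite !rspmE => /(spm_fun (fun z => rc (f (rp z))) uU uP).
have E (Q : 'M[K]_n) c : spm Q ((fun z => rc (f (rp z))) \o (fun i => rc (c i))) =
    spm Q (fun i => rc ((f \o c) i)).
  by apply: eq_spm => i /=; rewrite rcK.
by rewrite !E.
Qed.

Lemma rspm_pow_invl P (s : 'I_n -> R) (t : R) : P \is unitarymx -> (forall i, 0 < s i) ->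
  rspm P (fun i => Rpower (s i) (- t)) *m rspm P (fun i => Rpower (s i) t) = 1%:M.
Proof.
move=> uP s0; rewrite (rspmM _ _ uP) -(rspm1 uP); apply: eq_rspm => i.
by rewrite -rpowD addNr rpow0.
Qed.

Lemma rspm_pow_invr P (s : 'I_n -> R) (t : R) : P \is unitarymx -> (forall i, 0 < s i) ->
  rspm P (fun i => Rpower (s i) t) *m rspm P (fun i => Rpower (s i) (- t)) = 1%:M.
Proof. by move=> uP s0; rewrite (mulmx1C (rspm_pow_invl t uP s0)). Qed.

Lemma rspm_unitary_l P U a : rspm (P *m U) a = P *m rspm U a *m P^t*.
Proof. by rewrite !rspmE /spm adjM !mulmxA. Qed.

Lemma tr_rspm U a : U \is unitarymx -> \tr (rspm U a) = rc (\sum_i a i).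
Proof. by move=> uU; rewrite rspmE (tr_spm _ uU) rc_sum. Qed.

(** Conjugation by [P] makes [sigma] diagonal, as in [araki_lieb_thirring]. There, equality says
    that [W] has no entry between distinct eigenvalues of [sigma], that is, commutes with it. *)
Lemma alt_pos P U S (s om y q : 'I_n -> R) (g : R) :
  P \is unitarymx -> U \is unitarymx -> S \is unitarymx ->
  (forall i, 0 < s i) -> (forall i, 0 < om i) -> (forall i, 0 < y i) ->
  0 < g -> g < 1 -> (forall k, rc (q k) = (U^t* *m rspm P s *m U) k k) ->
  rspm P (fun i => Rpower (s i) (g / 2)) *m rspm U (fun i => Rpower (om i) g) *m
    rspm P (fun i => Rpower (s i) (g / 2)) = rspm S y ->
  \sum_j Rpower (y j) g^-1 <= \sum_k q k * om k /\
  (\sum_j Rpower (y j) g^-1 = \sum_k q k * om k ->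
   rspm P s *m rspm U om = rspm U om *m rspm P s).
Proof.
move=> uP uU uS s0 om0 y0 g0 g1 Eq Z.
pose T := P^t* *m U; pose T' := P^t* *m S.
have uT : T \is unitarymx by rewrite mul_unitarymx ?trmxC_unitary.
have uT' : T' \is unitarymx by rewrite mul_unitarymx ?trmxC_unitary.
have back M : P *m (P^t* *m M) = M by rewrite mulmxA (unitarymxP uP) mul1mx.
have TE V a : rspm (P^t* *m V) a = P^t* *m rspm V a *m P.
  by rewrite rspm_unitary_l trmxCK.
have Z' : dg (fun i => rc (Rpower (s i) (g / 2))) *m
    spm T (fun i => rc (Rpower (om i) g)) *m
    dg (fun i => rc (Rpower (s i) (g / 2))) = spm T' (fun i => rc (y i)).
  have -> : spm T' (fun i => rc (y i)) = P^t* *m rspm S y *m P.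
    by rewrite -TE rspmE.
  rewrite -Z -rspmE TE !(rspmE P) /spm !mulmxA.
  rewrite unitary_mulVmx // mul1mx -[RHS]mulmxA unitary_mulVmx // mulmx1.
  by [].
have W0 k : 0 < spm T (fun i => rc (om i)) k k.
  by apply/posm_diag1/spm_posm => // i; rewrite rc_gt0.
have [|h1 h2] := araki_lieb_thirring uT uT' om0 s0 y0 g0 g1
  (a' := fun k => rp (spm T (fun i => rc (om i)) k k)) _ Z'.
  by move=> k; rewrite rpK // gtr0_real.
have E : \sum_k s k * rp (spm T (fun i => rc (om i)) k k) = \sum_k q k * om k.
  apply: rc_inj; rewrite !rc_sum.
  transitivity (\tr (rspm P s *m rspm U om)); last first.
    rewrite (rspmE U) tr_mul_spm; apply: eq_bigr => k _.
    by rewrite rcM Eq mulrC.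
  rewrite mxtrace_mulC (rspmE P) tr_mul_spm; apply: eq_bigr => k _.
  by rewrite rcM rpK ?gtr0_real // -rspmE TE.
rewrite E in h1 h2; split=> // /h2 c.
rewrite -rspmE in c.
have cT : rspm T om *m dg (fun i => rc (s i)) = dg (fun i => rc (s i)) *m rspm T om.
  apply/matrixP => i j; rewrite mul_dgE dg_mulE mulrC.
  have [->|/c ->//] := eqVneq (rspm T om i j) 0; by rewrite !mulr0.
have UE : rspm U om = P *m rspm T om *m P^t*.
  by rewrite -rspm_unitary_l back.
have sE : rspm P s = P *m dg (fun i => rc (s i)) *m P^t* by rewrite rspmE.
rewrite UE sE; move: (rspm T om) (dg _) cT => A B AB; rewrite !mulmxA.
rewrite -!(mulmxA _ (P^t* ) P) unitary_mulVmx // !mulmx1.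
by rewrite -!(mulmxA P) AB.
Qed.

(** A negative [be] is reduced to [- be] by inverting the whole product: its eigenvalues become
    [y^-1], and [(y^-1)^(1/(-be)) = y^(1/be)]. *)
Lemma alt_signed P U S (s om y q : 'I_n -> R) (be : R) :
  P \is unitarymx -> U \is unitarymx -> S \is unitarymx ->
  (forall i, 0 < s i) -> (forall i, 0 < om i) -> (forall i, 0 < y i) ->
  be != 0 -> `|be| < 1 -> (forall k, rc (q k) = (U^t* *m rspm P s *m U) k k) ->
  rspm P (fun i => Rpower (s i) (be / 2)) *m rspm U (fun i => Rpower (om i) be) *m
    rspm P (fun i => Rpower (s i) (be / 2)) = rspm S y ->
  \sum_j Rpower (y j) be^-1 <= \sum_k q k * om k /\
  (\sum_j Rpower (y j) be^-1 = \sum_k q k * om k ->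
   rspm P s *m rspm U om = rspm U om *m rspm P s).
Proof.
move=> uP uU uS s0 om0 y0 be0 be1 Eq Y.
have [lt0|gt0] := ltP be 0; last first.
  apply: (alt_pos uP uU uS s0 om0 y0 _ _ Eq Y); first by rewrite lt_def be0.
  by rewrite -(ger0_norm gt0).
pose y' i := Rpower (y i) (- 1).
have y'0 i : 0 < y' i by exact: rpow_gt0.
have g0 : 0 < - be by rewrite oppr_gt0.
have g1 : - be < 1 by rewrite -(ltr0_norm lt0).
have sumE : \sum_j Rpower (y' j) (- be)^-1 = \sum_j Rpower (y j) be^-1.
  by apply: eq_bigr => j _; rewrite rpowM invrN mulrNN mul1r.
rewrite -sumE; apply: (alt_pos uP uU uS s0 om0 y'0 g0 g1 Eq).
have yy : rspm S y' *m rspm S y = 1%:M.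
  rewrite (rspmM _ _ uS) -(rspm1 uS); apply: eq_rspm => j.
  by rewrite /y' -{2}(rpow1 (y0 j)) -rpowD addNr rpow0.
have -> : rspm P (fun i => Rpower (s i) (- be / 2)) =
    rspm P (fun i => Rpower (s i) (- (be / 2))).
  by apply: eq_rspm => i; rewrite mulNr.
rewrite -[LHS]mulmx1 -(mulmx1C yy) -Y.
rewrite !mulmxA -(mulmxA _ (rspm P _) (rspm P _)) rspm_pow_invl // mulmx1.
rewrite -(mulmxA _ (rspm U _) (rspm U _)) rspm_pow_invl // mulmx1.
by rewrite rspm_pow_invl // mul1mx.
Qed.

Lemma renyi_bound (rho P V U : 'M[K]_n) (s x om r q : 'I_n -> R) (al : R) :
  let be := (al - 1) / al in
  P \is unitarymx -> V \is unitarymx -> U \is unitarymx ->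
  (forall i, 0 < s i) -> (forall i, 0 < x i) -> (forall i, 0 < om i) ->
  1 / 2 < al -> al != 1 ->
  rspm P (fun i => Rpower (s i) (- (be / 2))) *m rho *m
    rspm P (fun i => Rpower (s i) (- (be / 2))) = rspm V x ->
  (forall k, rc (r k) = (U^t* *m rho *m U) k k) ->
  (forall k, rc (q k) = (U^t* *m rspm P s *m U) k k) ->
  let Psi := al * (\sum_k r k * Rpower (om k) be) + (1 - al) * (\sum_k q k * om k) in
  0 <= (al - 1) * (\sum_i Rpower (x i) al - Psi) /\
  (Psi = \sum_i Rpower (x i) al -> rho *m rspm P s = rspm P s *m rho).
Proof.
move=> be uP uV uU s0 x0 om0 al2 al1 X Er Eq Psi.
have al0 : 0 < al by apply: lt_trans al2; rewrite divr_gt0.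
have aln0 : al != 0 by rewrite gt_eqF.
have d0 : al - 1 != 0 by rewrite subr_eq0.
have be0 : be != 0 by rewrite mulf_neq0 // invr_eq0.
(* For [al > 0] the condition [1/2 < al] is exactly [be > -1]. *)
have be1 : `|be| < 1.
  rewrite /be ltr_norml ltr_pdivlMr // ltr_pdivrMr // mul1r gtrBl ltr01 andbT.
  by move: al2; rewrite ltr_pdivrMr // => h; lra.
pose Sp t := rspm P (fun i => Rpower (s i) t).
pose Y := Sp (be / 2) *m rspm U (fun i => Rpower (om i) be) *m Sp (be / 2).
have SpA t : (Sp t)^t* = Sp t by exact: adj_rspm.
have pY : posm Y.
  split; first by rewrite /Y !adjM !SpA adj_rspm mulmxA.
  move=> v v0; pose v' := Sp (be / 2) *m v.
  have -> : v^t* *m Y *m v = v'^t* *m rspm U (fun i => Rpower (om i) be) *m v'.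
    by rewrite /v' adjM SpA /Y !mulmxA.
  have pU : posm (rspm U (fun i => Rpower (om i) be)).
    by apply: rspm_posm => // i; exact: rpow_gt0.
  apply: (proj2 pU); apply: contra v0 => /eqP h; apply/eqP.
  by rewrite -[v]mul1mx -(rspm_pow_invl (be / 2)%R uP s0) -mulmxA -/(Sp _) -/v' h mulmx0.
have [S [yC [uS yC0 YE]]] := posm_spectral pY.
pose y i := rp (yC i).
have yE i : rc (y i) = yC i by rewrite rpK // gtr0_real.
have y0 i : 0 < y i by rewrite -rc_gt0 yE.
have {}YE : Y = rspm S y by rewrite YE rspmE; apply: eq_spm => i; rewrite yE.
have [a1 a2] := alt_signed uP uU uS s0 om0 y0 be0 be1 Eq YE.
have rhoE : rho = Sp (be / 2) *m rspm V x *m Sp (be / 2).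
  rewrite -X !mulmxA rspm_pow_invr // mul1mx.
  by rewrite -mulmxA rspm_pow_invl // mulmx1.
have trE : \tr (rspm V x *m rspm S y) = rc (\sum_k r k * Rpower (om k) be).
  rewrite -YE /Y mulmxA mxtrace_mulC !mulmxA -rhoE rspmE tr_mul_spm rc_sum.
  by apply: eq_bigr => k _; rewrite rcM Er mulrC.
pose gap i j := Rpower (x i) al + (al - 1) * Rpower (y j) (al / (al - 1)) -
   al * (x i * y j).
have [e eE] : exists e : 'I_n -> 'I_n -> R, forall i j,
    rc (e i j) = `|(V^t* *m S) i j| ^+ 2.
  exists (fun i j => rp (`|(V^t* *m S) i j| ^+ 2)) => i j.
  by rewrite rpK // ger0_real // exprn_ge0.
have e0 i j : 0 <= e i j by rewrite -rc_ge0 eE exprn_ge0.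
have beV : be^-1 = al / (al - 1) by rewrite /be invf_div.
have gapE : \sum_i Rpower (x i) al + (al - 1) * (\sum_j Rpower (y j) be^-1) -
    al * (\sum_k r k * Rpower (om k) be) = \sum_i \sum_j gap i j * e i j.
  apply: rc_inj; rewrite rmorphB rmorphD !rcM -trE.
  have := tr_spm2_gap (fun z => rc (Rpower (rp z) al))
    (fun z => rc ((al - 1) * Rpower (rp z) (al / (al - 1)))) (rc al)
    (fun i => rc (x i)) (fun j => rc (y j)) uV uS.
  rewrite -!rspmE => E.
  transitivity (\sum_i rc (Rpower (rp (rc (x i))) al) +
    \sum_j rc ((al - 1) * Rpower (rp (rc (y j))) (al / (al - 1))) -
    rc al * \tr (rspm V x *m rspm S y)).
    congr (_ + _ - _); first by rewrite rc_sum; apply: eq_bigr => i _; rewrite rcK.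
    by rewrite -rcM mulr_sumr rc_sum; apply: eq_bigr => j _; rewrite rcK beV.
  rewrite E rc_sum; apply: eq_bigr => i _; rewrite rc_sum; apply: eq_bigr => j _.
  by rewrite !rcK [in RHS]rcM eE -[rc (x i) * _]rcM -[rc al * _]rcM -rmorphD -rmorphB.
have yg i j := young_renyi al0 al1 (x0 i) (y0 j).
have G0 : 0 <= (al - 1) * \sum_i \sum_j gap i j * e i j.
  rewrite mulr_sumr sumr_ge0 // => i _; rewrite mulr_sumr sumr_ge0 // => j _.
  by rewrite mulrA mulr_ge0 // (proj1 (yg i j)).
(* The deficit is the Young gap plus the Araki-Lieb-Thirring gap; the latter carries the square of
   [al - 1], so its direction is the same for all [al]. *)
have split_gap : (al - 1) * (\sum_i Rpower (x i) al - Psi) =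
    (al - 1) * (\sum_i \sum_j gap i j * e i j) +
    (al - 1) ^+ 2 * (\sum_k q k * om k - \sum_j Rpower (y j) be^-1).
  by rewrite -gapE /Psi; ring.
have sq0 : 0 < (al - 1) ^+ 2 by rewrite lt_def sqr_ge0 sqrf_eq0 d0.
have T0 : 0 <= (al - 1) ^+ 2 * (\sum_k q k * om k - \sum_j Rpower (y j) be^-1).
  by rewrite mulr_ge0 ?sqr_ge0 // subr_ge0.
split; first by rewrite split_gap addr_ge0.
move=> E; move: split_gap; rewrite E subrr mulr0 => /esym /eqP.
rewrite paddr_eq0 // => /andP[/eqP g0 /eqP t0].
have cW : rspm P s *m rspm U om = rspm U om *m rspm P s.
  apply: a2; apply/eqP; rewrite eq_sym -subr_eq0.
  by move/eqP: t0; rewrite mulf_eq0 (gt_eqF sq0).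
(* A pair of eigenvectors with nonzero overlap is an equality case of Young, so [X] is the power
   [1/(al-1)] of [Y]. *)
have xy i j : (V^t* *m S) i j != 0 -> x i = Rpower (y j) (al - 1)^-1.
  move=> nz; apply: (proj2 (yg i j)).
  move/eqP: g0; rewrite mulr_sumr psumr_eq0 => [/allP /(_ i (mem_index_enum i))|k _].
    rewrite /= mulr_sumr psumr_eq0 => [/allP /(_ j (mem_index_enum j))|k _].
      rewrite /= mulrA mulf_eq0 => /orP[/eqP //|/eqP ez].
      have := eE i j; rewrite ez rmorph0 => /esym /eqP.
      by rewrite sqrf_eq0 normr_eq0 (negPf nz).
    by rewrite mulrA mulr_ge0 // (proj1 (yg i k)).
  rewrite mulr_sumr sumr_ge0 // => l _.
  by rewrite mulrA mulr_ge0 // (proj1 (yg k l)).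
have XE : rspm V x = rspm S (fun j => Rpower (y j) (al - 1)^-1).
  have inter : dg (fun i => rc (x i)) *m (V^t* *m S) =
      (V^t* *m S) *m dg (fun j => rc (Rpower (y j) (al - 1)^-1)).
    apply/matrixP => i j; rewrite dg_mulE mul_dgE mulrC.
    have [->|/xy <- //] := eqVneq ((V^t* *m S) i j) 0; by rewrite !mul0r.
  have := congr1 (fun M => V *m M *m S^t* ) inter; rewrite /= !mulmxA.
  rewrite (unitarymxP uV) mul1mx !rspmE /spm => <-.
  by rewrite -(mulmxA _ S) (unitarymxP uS) mulmx1.
(* Commutation with [sigma] passes from [W] to [W^be], then to [Y], [X] and [rho]. *)
have cU : rspm P s *m rspm U (fun i => Rpower (om i) be) =
    rspm U (fun i => Rpower (om i) be) *m rspm P s.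
  exact: (commute_rspm_fun (fun z => Rpower z be) uU cW).
have cS t : rspm P s *m Sp t = Sp t *m rspm P s.
  by rewrite /Sp !rspmM //; apply: eq_rspm => i; rewrite mulrC.
have cY : rspm P s *m rspm S y = rspm S y *m rspm P s.
  rewrite -YE /Y !mulmxA cS -(mulmxA (Sp _) (rspm P s)) cU.
  by rewrite -!mulmxA cS.
have cX : rspm P s *m rspm V x = rspm V x *m rspm P s.
  rewrite XE; exact: (commute_rspm_fun (fun z => Rpower z (al - 1)^-1) uS cY).
rewrite rhoE !mulmxA cS -(mulmxA (Sp _) (rspm P s)) cX.
by rewrite -!mulmxA cS.
Qed.

(** * From measurements to a functional of [W] *)

(** The sum of all eigenvalues dominates each of them, and the sum of their inverses gives the lower
    bound; adding [1] keeps both bounds positive even in dimension zero. *)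
Lemma tr_bounds (A : 'M[K]_n) : posm A -> exists lo hi : R, [/\ 0 < lo, 0 < hi &
  forall M, psdm M -> rc lo * \tr M <= \tr (A *m M) <= rc hi * \tr M].
Proof.
move=> /posm_spectral [U [a [uU a0 ->]]].
pose b i := rp (a i); have bE i : rc (b i) = a i by rewrite rpK // gtr0_real.
have b0 i : 0 < b i by rewrite -rc_gt0 bE.
have sb0 : 0 <= \sum_i b i by apply: sumr_ge0 => i _; rewrite ltW.
have sv0 : 0 <= \sum_i (b i)^-1 by apply: sumr_ge0 => i _; rewrite invr_ge0 ltW.
exists (1 + \sum_i (b i)^-1)^-1, (1 + \sum_i b i).
have lo0 : 0 < 1 + \sum_i (b i)^-1 by rewrite ltr_wpDr.
rewrite invr_gt0 lo0 ltr_wpDr //; split=> // M pM.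
have trM : \tr M = \sum_k (U^t* *m M *m U) k k.
  by rewrite -[RHS]/(\tr _) mxtrace_mulC mulmxA (unitarymxP uU) mul1mx.
rewrite mxtrace_mulC tr_mul_spm trM !mulr_sumr.
apply/andP; split; apply: ler_sum => k _; apply: ler_wpM2r; rewrite ?psdm_diag //.
  rewrite -bE rc_le -[leRHS]invrK lef_pV2 ?posrE ?invr_gt0 //.
  rewrite (bigD1 k) //= addrCA lerDl addr_ge0 // sumr_ge0 // => i _.
  by rewrite invr_ge0 ltW.
rewrite -bE rc_le (bigD1 k) //= addrCA lerDl addr_ge0 // sumr_ge0 // => i _.
by rewrite ltW.
Qed.

Definition rdiag (A U : 'M[K]_n) k : R := rp ((U^t* *m A *m U) k k).

(** This is [Psi(W)] for [W] with eigenbasis [U] and eigenvalues [om], written in these data so that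
    limits can be taken coordinate by coordinate. *)
Definition renyi_psi (al : R) (rho sigma U : 'M[K]_n) (om : 'I_n -> R) : R :=
  al * (\sum_k rdiag rho U k * Rpower (om k) ((al - 1) / al)) +
  (1 - al) * (\sum_k rdiag sigma U k * om k).

Lemma rdiagE (A U : 'M[K]_n) k : psdm A -> rc (rdiag A U k) = (U^t* *m A *m U) k k.
Proof. by move=> pA; rewrite rpK // ger0_real // psdm_diag. Qed.

Lemma le_rpow (x y s : R) : 0 < x -> x <= y -> 0 <= s -> Rpower x s <= Rpower y s.
Proof.
move=> /RltP x0 /RleP xy /RleP s0; apply/RleP.
exact: (Rle_Rpower_l x y s s0 (conj x0 xy)).
Qed.

(** For [al < 1] the exponent is negative and [resolvent_jensen] integrates directly. For [al > 1]
    one writes [t^beta = t * t^(-(1-beta))] and [t / (t + s) = 1 - s / (t + s)]: the direction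
    flips, and the constants cancel because both sides have total [tr rho]. *)
Lemma power_jensen (I : finType) (M : I -> 'M[K]_n) (w p : I -> R) (U rho : 'M[K]_n)
    (om : 'I_n -> R) (al : R) :
  0 < al -> al != 1 -> `|(al - 1) / al| < 1 ->
  U \is unitarymx -> (forall x, psdm (M x)) -> \sum_x M x = 1%:M ->
  \sum_x rc (w x) *: M x = rspm U om -> psdm rho ->
  (forall x, 0 < w x) -> (forall k, 0 < om k) ->
  (forall x, rc (p x) = \tr (rho *m M x)) ->
  0 <= (al - 1) * (\sum_k rdiag rho U k * Rpower (om k) ((al - 1) / al) -
                   \sum_x p x * Rpower (w x) ((al - 1) / al)).
Proof.
move=> al0 al1 be1 uU pM M1 MW prho w0 om0 pE; set be := (al - 1) / al.
have J s : 0 < s -> \sum_k rdiag rho U k / (om k + s) <= \sum_x p x / (w x + s).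
  move=> s0; rewrite -rc_le !rc_sum.
  have -> : \sum_i rc (rdiag rho U i / (om i + s)) =
      \sum_k (U^t* *m rho *m U) k k / (rc (om k) + rc s).
    by apply: eq_bigr => k _; rewrite rcM fmorphV rmorphD rdiagE.
  have -> : \sum_i rc (p i / (w i + s)) =
      \sum_x \tr (rho *m M x) / (rc (w x) + rc s).
    by apply: eq_bigr => x _; rewrite rcM fmorphV rmorphD pE.
  rewrite rspmE in MW.
  by apply: (resolvent_jensen uU pM M1 MW prho) => *; rewrite rc_gt0.
have tot : \sum_k rdiag rho U k = \sum_x p x.
  apply: rc_inj; rewrite !rc_sum.
  transitivity (\tr rho).
    under eq_bigr => k _ do rewrite rdiagE //.
    by rewrite -[LHS]/(\tr _) mxtrace_mulC mulmxA (unitarymxP uU) mul1mx.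
  under eq_bigr => x _ do rewrite pE.
  by rewrite -raddf_sum -mulmx_sumr M1 mulmx1.
pose I' := ('I_n + I)%type.
pose t (z : I') := match z with inl k => om k | inr x => w x end.
have t0 z : 0 < t z by case: z.
have [lt1|gt1|e] := ltgtP al 1; last by rewrite e eqxx in al1.
  have be0 : be < 0 by rewrite pmulr_llt0 ?invr_gt0 // subr_lt0.
  pose c (z : I') := match z with inl k => - rdiag rho U k | inr x => p x end.
  have g0 : 0 < - be by rewrite oppr_gt0.
  have g1 : - be < 1 by rewrite -(ltr0_norm be0).
  have [|h _] := resolvent_power g0 g1 t0 (c := c).
    move=> s s0; rewrite big_sumType /=; under eq_bigr do rewrite mulNr.
    by rewrite sumrN addrC subr_ge0 J.
  rewrite nmulr_rge0 ?subr_lt0 // subr_le0; move: h.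
  rewrite big_sumType /= opprK; under eq_bigr do rewrite mulNr.
  by rewrite sumrN addrC subr_ge0.
have be0 : 0 < be by rewrite divr_gt0 // subr_gt0.
pose c (z : I') := match z with inl k => rdiag rho U k * om k | inr x => - (p x * w x) end.
have g0 : 0 < 1 - be by rewrite subr_gt0 -(gtr0_norm be0).
have g1 : 1 - be < 1 by rewrite gtrBl.
have [|h _] := resolvent_power g0 g1 t0 (c := c).
  move=> s s0; rewrite big_sumType /=.
  have fr (u v : R) : 0 < v -> u * v / (v + s) = u - s * (u / (v + s)).
    by move=> v0; field; rewrite gt_eqF // addr_gt0.
  under eq_bigr => k _ do rewrite fr //.
  under [X in _ + X]eq_bigr => x _ do rewrite mulNr fr //.
  rewrite sumrN !sumrB -!mulr_sumr tot opprB addrC addrA subrK.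
  rewrite -mulrBr; apply: mulr_ge0; first exact: ltW.
  by rewrite subr_ge0 J.
rewrite pmulr_rge0 ?subr_gt0 //; move: h; rewrite big_sumType /=.
have fr (v : R) : 0 < v -> v * Rpower v (- (1 - be)) = Rpower v be.
  by move=> v0; rewrite -{1}(rpow1 v0) -rpowD opprB addrCA subrr addr0.
under eq_bigr => k _ do rewrite -mulrA fr //.
under [X in _ + X]eq_bigr => x _ do rewrite mulNr -mulrA fr //.
by rewrite sumrN.
Qed.

(** [L] and [H] are fixed before the POVM: the compactness argument needs one range for all
    measurements. *)
Lemma measured_psi (rho sigma : 'M[K]_n) (al : R) : posm rho -> posm sigma ->
  1 / 2 < al -> al != 1 -> exists L H : R, 0 < L /\
  forall (I : finType) (M : I -> 'M[K]_n) (p q : I -> R),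
    (forall x, psdm (M x)) -> \sum_x M x = 1%:M ->
    (forall x, rc (p x) = \tr (rho *m M x)) ->
    (forall x, rc (q x) = \tr (sigma *m M x)) ->
  exists U om, [/\ U \is unitarymx, forall k, L <= om k <= H &
    0 <= (al - 1) * (renyi_psi al rho sigma U om -
      \sum_x if p x == 0 then 0 else Rpower (p x) al * Rpower (q x) (1 - al))].
Proof.
move=> prho psig al2 al1.
have al0 : 0 < al by apply: lt_trans al2; rewrite divr_gt0.
have aln0 : al != 0 by rewrite gt_eqF.
have be1 : `|(al - 1) / al| < 1.
  rewrite ltr_norml ltr_pdivlMr // ltr_pdivrMr // mul1r gtrBl ltr01 andbT.
  by move: al2; rewrite ltr_pdivrMr // => h; lra.
have [l1 [h1 [l10 h10 B1]]] := tr_bounds prho.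
have [l2 [h2 [l20 h20 B2]]] := tr_bounds psig.
(* Both [p] and [q] are comparable to [tr (M x)], which confines their ratio to [[l1 / h2, h1 / l2]]
   whatever the measurement. *)
pose L := Rpower (l1 / h2) al; pose H := Rpower (h1 / l2) al.
have L0 : 0 < L by exact: rpow_gt0.
exists L, (Num.max L H); split=> // I M p q pM M1 pE qE.
(* If [p x = 0] then [tr (M x) = 0] and [q x = 0], so the outcome contributes nothing; the default
   [L] keeps the weight positive and in range. *)
pose w x := if p x == 0 then L else Rpower (p x / q x) al.
pose t x := rp (\tr (M x)).
have t00 x : 0 <= \tr (M x).
  by have := psdm_tr 1%:M (pM x); rewrite mulmx1 trmx1 map_mx1 mul1mx.
have tE x : rc (t x) = \tr (M x) by rewrite rpK // ger0_real.
have t0 x : 0 <= t x by rewrite -rc_ge0 tE.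
have bp x : l1 * t x <= p x <= h1 * t x.
  by rewrite -!rc_le !rcM tE pE B1.
have bq x : l2 * t x <= q x <= h2 * t x.
  by rewrite -!rc_le !rcM tE qE B2.
have pos x : p x != 0 -> [/\ 0 < t x, 0 < p x & 0 < q x].
  move=> px; have tn : t x != 0.
    by apply: contra px => /eqP e; have := bp x; rewrite e !mulr0 -eq_le eq_sym.
  have tp : 0 < t x by rewrite lt_def tn t0.
  split=> //; first by apply: lt_le_trans (proj1 (andP (bp x))); rewrite mulr_gt0.
  by apply: lt_le_trans (proj1 (andP (bq x))); rewrite mulr_gt0.
have q0 x : p x = 0 -> q x = 0.
  move=> px; have := bp x; rewrite px => /andP[u _].
  have e : t x = 0.
    by apply/eqP; rewrite eq_le t0 andbT -(pmulr_rle0 _ l10).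
  by have := bq x; rewrite e !mulr0 -eq_le => /eqP <-.
have wB x : L <= w x <= Num.max L H.
  rewrite /w; case: eqVneq => [_|/pos [tp pp qp]]; first by rewrite lexx le_max lexx.
  have /andP[pl ph] := bp x; have /andP[ql qh] := bq x.
  have r1 : l1 / h2 <= p x / q x.
    rewrite ler_pdivrMr // mulrAC ler_pdivlMr //.
    apply: (le_trans (ler_wpM2l (ltW l10) qh)).
    by rewrite mulrCA mulrC ler_pM2r.
  have r2 : p x / q x <= h1 / l2.
    rewrite ler_pdivrMr // mulrAC ler_pdivlMr // mulrC.
    apply: (le_trans (ler_wpM2l (ltW l20) ph)).
    by rewrite mulrCA ler_pM2l.
  have r0 : 0 < l1 / h2 by exact: divr_gt0.
  have r3 : 0 < p x / q x by exact: divr_gt0.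
  apply/andP; split; first exact: (le_rpow r0 r1 (ltW al0)).
  by rewrite le_max (le_rpow r3 r2 (ltW al0)) orbT.
have w0 x : 0 < w x by apply: lt_le_trans L0 _; have /andP[] := wB x.
pose W := \sum_x rc (w x) *: M x.
have hW : W^t* = W.
  apply/matrixP => i j; rewrite adjE !summxE rmorph_sum; apply: eq_bigr => x _.
  by rewrite !mxE rmorphM /= conj_Creal ?rc_real // -adjE (proj1 (pM x)).
have [U [a [uU ra WE]]] := hermitian_spectral hW.
pose om k := rp (a k); have omE k : rc (om k) = a k by rewrite rpK.
have WE' : W = rspm U om by rewrite WE rspmE; apply: eq_spm => k.
have omD k : rc (om k) = \sum_x rc (w x) * (U^t* *m M x *m U) k k.
  have -> : rc (om k) = (U^t* *m W *m U) k k.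
    rewrite WE /spm !mulmxA unitary_mulVmx // mul1mx.
    by rewrite -mulmxA unitary_mulVmx // mulmx1 !mxE eqxx mulr1n.
  rewrite /W mulmx_sumr mulmx_suml summxE; apply: eq_bigr => x _.
  by rewrite -scalemxAr -scalemxAl mxE.
have one k : \sum_x (U^t* *m M x *m U) k k = 1.
  rewrite -summxE -mulmx_suml -mulmx_sumr M1 mulmx1 unitary_mulVmx //.
  by rewrite mxE eqxx.
(* By [omD] and [one], each eigenvalue of [W] is a weighted average of the [w x]. *)
have omB k : L <= om k <= Num.max L H.
  rewrite -!rc_le omD -[X in X <= _ <= _]mulr1 -[X in _ <= _ <= X]mulr1 -(one k).
  rewrite !mulr_sumr; apply/andP; split; apply: ler_sum => x _;
    by apply: ler_wpM2r; rewrite ?psdm_diag // rc_le; have /andP[] := wB x.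
have om0 k : 0 < om k by apply: lt_le_trans L0 _; have /andP[] := omB k.
exists U, om; split=> //.
have J := power_jensen al0 al1 be1 uU pM M1 WE' (posm_psdm prho) w0 om0 pE.
have Q : \sum_k rdiag sigma U k * om k = \sum_x q x * w x.
  apply: rc_inj; rewrite !rc_sum; transitivity (\tr (sigma *m W)).
    rewrite WE tr_mul_spm; apply: eq_bigr => k _.
    by rewrite rcM omE (rdiagE _ _ (posm_psdm psig)) mulrC.
  rewrite /W mulmx_sumr raddf_sum; apply: eq_bigr => x _ /=.
  by rewrite -scalemxAr mxtraceZ rcM qE mulrC.
(* With [w = (p / q)^al], both [p w^beta] and [q w] equal [p^al q^(1-al)]. *)
have V : \sum_x (if p x == 0 then 0 else Rpower (p x) al * Rpower (q x) (1 - al)) =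
    al * (\sum_x p x * Rpower (w x) ((al - 1) / al)) + (1 - al) * (\sum_x q x * w x).
  rewrite !mulr_sumr -big_split; apply: eq_bigr => x _ /=; rewrite /w.
  case: (eqVneq (p x) 0) => [px|px]; first by rewrite px q0 // !mul0r !mulr0 addr0.
  have [_ pp qp] := pos x px.
  have e1 : p x * Rpower (Rpower (p x / q x) al) ((al - 1) / al) =
      Rpower (p x) al * Rpower (q x) (1 - al).
    rewrite rpowM mulrCA mulfV // mulr1 rpow_mull ?invr_gt0 // rpow_invl // opprB.
    by rewrite mulrA -{1}(rpow1 pp) -rpowD addrC subrK.
  have e2 : q x * Rpower (p x / q x) al = Rpower (p x) al * Rpower (q x) (1 - al).
    rewrite rpow_mull ?invr_gt0 // rpow_invl // mulrCA; congr (_ * _).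
    by rewrite -{1}(rpow1 qp) -rpowD.
  by rewrite e1 e2; ring.
rewrite V /renyi_psi Q; move: J; set A := \sum_k _; set B := \sum_x _ => J.
have -> : (al - 1) * (al * A + (1 - al) * \sum_x q x * w x -
    (al * B + (1 - al) * \sum_x q x * w x)) = al * ((al - 1) * (A - B)) by ring.
by rewrite mulr_ge0 // ltW.
Qed.

(** * Limits and compactness *)

Lemma cv_ext (u v : nat -> R) (l : R) : Un_cv u l -> u =1 v -> Un_cv v l.
Proof. by move=> h e; apply: Un_cv_ext h. Qed.

(** [K] is an abstract field without topology, so limits are taken on real and imaginary parts in
    [R]. *)
Definition cvK (z : nat -> K) (l : K) : Prop :=
  Un_cv (fun m => rp ('Re (z m))) (rp ('Re l)) /\
  Un_cv (fun m => rp ('Im (z m))) (rp ('Im l)).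

Lemma rpD (x y : K) : x \is Num.real -> y \is Num.real -> rp (x + y) = rp x + rp y.
Proof. by move=> rx ry; apply: rc_inj; rewrite rmorphD !rpK // rpredD. Qed.

Lemma rpM (x y : K) : x \is Num.real -> y \is Num.real -> rp (x * y) = rp x * rp y.
Proof. by move=> rx ry; apply: rc_inj; rewrite rcM !rpK // rpredM. Qed.

Lemma rpN (x : K) : x \is Num.real -> rp (- x) = - rp x.
Proof. by move=> rx; apply: rc_inj; rewrite rmorphN !rpK // rpredN. Qed.

Lemma cvK_ext z z' l : cvK z l -> z =1 z' -> cvK z' l.
Proof.
move=> [h1 h2] e; split.
  by apply: (cv_ext h1) => m; rewrite e.
by apply: (cv_ext h2) => m; rewrite e.
Qed.

Lemma cvK_cst (c : K) : cvK (fun=> c) c.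
Proof. by split; apply: Un_cv_const. Qed.

Lemma cvKD z z' l l' : cvK z l -> cvK z' l' -> cvK (fun m => z m + z' m) (l + l').
Proof.
move=> [h1 h2] [h1' h2']; split.
  rewrite raddfD rpD ?Creal_Re //; apply: (cv_ext (CV_plus _ _ _ _ h1 h1')) => m.
  by rewrite raddfD rpD ?Creal_Re.
rewrite raddfD rpD ?Creal_Im //; apply: (cv_ext (CV_plus _ _ _ _ h2 h2')) => m.
by rewrite raddfD rpD ?Creal_Im.
Qed.

Lemma rp_ReM (x y : K) :
  rp ('Re (x * y)) = rp ('Re x) * rp ('Re y) - rp ('Im x) * rp ('Im y).
Proof.
by rewrite ReM rpD ?rpN ?rpM ?rpredN ?rpredM ?Creal_Re ?Creal_Im.
Qed.

Lemma rp_ImM (x y : K) :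
  rp ('Im (x * y)) = rp ('Re x) * rp ('Im y) + rp ('Re y) * rp ('Im x).
Proof. by rewrite ImM rpD ?rpM ?rpredM ?Creal_Re ?Creal_Im. Qed.

Lemma cvKM z z' l l' : cvK z l -> cvK z' l' -> cvK (fun m => z m * z' m) (l * l').
Proof.
move=> [h1 h2] [h1' h2']; split.
  rewrite rp_ReM.
  apply: (cv_ext (CV_minus _ _ _ _ (CV_mult _ _ _ _ h1 h1') (CV_mult _ _ _ _ h2 h2'))).
  by move=> m; rewrite rp_ReM.
rewrite rp_ImM.
apply: (cv_ext (CV_plus _ _ _ _ (CV_mult _ _ _ _ h1 h2') (CV_mult _ _ _ _ h1' h2))).
by move=> m; rewrite rp_ImM.
Qed.

Lemma cvK_conj z l : cvK z l -> cvK (fun m => (z m)^*) (l^*).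
Proof.
move=> [h1 h2]; split.
  by rewrite Re_conj; apply: (cv_ext h1) => m; rewrite Re_conj.
rewrite Im_conj rpN ?Creal_Im //; apply: (cv_ext (CV_opp _ _ h2)) => m.
by rewrite /opp_seq Im_conj rpN ?Creal_Im.
Qed.

Lemma cvK_sum (I : finType) (z : nat -> I -> K) (l : I -> K) :
  (forall i, cvK (z^~ i) (l i)) -> cvK (fun m => \sum_i z m i) (\sum_i l i).
Proof.
move=> h; elim: (index_enum I) => [|i s IH].
  by rewrite big_nil; apply: (cvK_ext (cvK_cst 0)) => m; rewrite big_nil.
by rewrite big_cons; apply: (cvK_ext (cvKD (h i) IH)) => m; rewrite big_cons.
Qed.

Lemma Un_cv_sum (I : finType) (z : nat -> I -> R) (l : I -> R) :
  (forall i, Un_cv (z^~ i) (l i)) -> Un_cv (fun m => \sum_i z m i) (\sum_i l i).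
Proof.
move=> h; elim: (index_enum I) => [|i s IH].
  rewrite big_nil; apply: (cv_ext (Un_cv_const 0)) => m; by rewrite big_nil.
by rewrite big_cons; apply: (cv_ext (CV_plus _ _ _ _ (h i) IH)) => m; rewrite big_cons.
Qed.

Lemma cvK_unique z l l' : cvK z l -> cvK z l' -> l = l'.
Proof.
move=> [h1 h2] [h1' h2'].
have r := UL_sequence _ _ _ h1 h1'; have i := UL_sequence _ _ _ h2 h2'.
rewrite [l]Crect [l']Crect -(rpK (Creal_Re l)) -(rpK (Creal_Im l)) r i.
by rewrite !rpK ?Creal_Re ?Creal_Im.
Qed.

(* The pairs [(U, om)] form a compact set, on which the objective is continuous. *)
Lemma psi_attained (rho sigma : 'M[K]_n) (al L H Q : R) : psdm rho -> psdm sigma ->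
  0 < L ->
  (forall eps, 0 < eps -> exists U om, [/\ U \is unitarymx, forall k, L <= om k <= H &
     `|renyi_psi al rho sigma U om - Q| <= eps]) ->
  exists U om, [/\ U \is unitarymx, forall k, 0 < om k &
     renyi_psi al rho sigma U om = Q].
Proof.
move=> prho psig L0 h.
have hm (m : nat) : exists Uo : 'M[K]_n * ('I_n -> R), [/\ Uo.1 \is unitarymx,
    forall k, L <= Uo.2 k <= H & `|renyi_psi al rho sigma Uo.1 Uo.2 - Q| <= m.+1%:R^-1].
  have e0 : 0 < (m.+1%:R^-1 : R) by rewrite invr_gt0 ltr0Sn.
  by have [U [om [uU B E]]] := h _ e0; exists (U, om).
have [F hF] := choice_nat _ _ hm.
(* The finitely many real coordinates: real and imaginary parts of the entries of [U], and the
   eigenvalues. *)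
pose J := ('I_n * 'I_n * bool + 'I_n)%type.
pose f m (j : J) : R := match j with
  | inl (i, k, true) => rp ('Re ((F m).1 i k))
  | inl (i, k, false) => rp ('Im ((F m).1 i k))
  | inr k => (F m).2 k end.
have absE (x B : R) : `|x| <= B -> Rle (Rabs x) B by move=> ?; apply/RleP; rewrite RabsE.
have nU U i k : U \is unitarymx -> `|U i k| ^+ 2 <= 1 :> K.
  move=> uU; rewrite -(unitary_sum_row i uU) (bigD1 k) //= lerDl.
  by rewrite sumr_ge0 // => j _; rewrite exprn_ge0.
have sq1 (x : K) : x \is Num.real -> x ^+ 2 <= 1 -> `|rp x| <= 1.
  move=> rx x1; rewrite -(@expr_le1 _ 2) // real_normK ?num_real //.
  by rewrite -rc_le rmorphXn rpK // rmorph1.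
have fB m j : Rle (Rabs (f m j)) (Num.max 1 H)%R.
  have [uU B _] := hF m; apply: absE; rewrite le_max.
  case: j => [[[i k] []]|k] /=.
  - rewrite sq1 ?Creal_Re //; apply: le_trans (nU _ i k uU).
    by rewrite normC2_Re_Im lerDl real_exprn_even_ge0 ?Creal_Im.
  - rewrite sq1 ?Creal_Im //; apply: le_trans (nU _ i k uU).
    by rewrite normC2_Re_Im lerDr real_exprn_even_ge0 ?Creal_Re.
  - have /andP[a b] := B k; rewrite ger0_norm ?b ?orbT //.
    by apply: le_trans a; exact: ltW.
have [phi [phi_ge cv]] := bounded_subsequence _ (index_enum J) _ _ fB.
have {}cv j : exists l, Un_cv (fun m => f (phi m) j) l.
  by apply: cv; apply: mem_In; exact: mem_index_enum.
have [l lE] : exists l : J -> R, forall j, Un_cv (fun m => f (phi m) j) (l j).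
  exists (fun j => epsilon (inhabits 0) (Un_cv (fun m => f (phi m) j))) => j.
  exact: epsilon_spec (cv j).
pose V : 'M[K]_n := \matrix_(i, k) (rc (l (inl (i, k, true))) + 'i * rc (l (inl (i, k, false)))).
pose om k := l (inr k).
have cvU i k : cvK (fun m => (F (phi m)).1 i k) (V i k).
  rewrite mxE; split.
    by rewrite Re_rect ?rc_real // rcK; exact: (lE (inl (i, k, true))).
  by rewrite Im_rect ?rc_real // rcK; exact: (lE (inl (i, k, false))).
have cvo k : Un_cv (fun m => (F (phi m)).2 k) (om k) by exact: (lE (inr k)).
have uV : V \is unitarymx.
  apply/unitarymxP/matrixP => i j.
  have c : cvK (fun m => \sum_k (F (phi m)).1 i k * ((F (phi m)).1 j k)^*)
      (\sum_k V i k * (V j k)^*).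
    by apply: cvK_sum => k; apply: cvKM => //; apply: cvK_conj.
  have -> : (V *m V^t* ) i j = \sum_k V i k * (V j k)^*.
    by rewrite mxE; apply: eq_bigr => k _; rewrite adjE.
  apply: (cvK_unique c); apply: (cvK_ext (cvK_cst _)) => m.
  have [uU _ _] := hF (phi m).
  have /matrixP /(_ i j) <- := unitarymxP uU.
  by rewrite mxE; apply: eq_bigr => k _; rewrite adjE.
(* The uniform bound [L] keeps the limiting spectrum positive, as continuity of the powers
   requires. *)
have om0 k : 0 < om k.
  apply: (lt_le_trans L0); apply/RleP; apply: Rle_cv_lim (Un_cv_const L) (cvo k) => m.
  by have [_ /(_ k) /andP[/RleP]] := hF (phi m).
have cvd A k : psdm A -> Un_cv (fun m => rdiag A (F (phi m)).1 k) (rdiag A V k).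
  move=> pA.
  have E U : (U^t* *m A *m U) k k = \sum_j (\sum_i (U i k)^* * A i j) * U j k.
    rewrite mxE; apply: eq_bigr => j _; rewrite mxE; congr (_ * _).
    by apply: eq_bigr => i _; rewrite adjE.
  have [c _] : cvK (fun m => ((F (phi m)).1^t* *m A *m (F (phi m)).1) k k)
      ((V^t* *m A *m V) k k).
    rewrite E; apply: (@cvK_ext (fun m => \sum_j (\sum_i ((F (phi m)).1 i k)^* * A i j) *
      (F (phi m)).1 j k)) _ => [|m]; last by rewrite E.
    apply: cvK_sum => j; apply: cvKM => //; apply: cvK_sum => i.
    by apply: cvKM; [apply: cvK_conj | apply: cvK_cst].
  have rR U : rp ('Re ((U^t* *m A *m U) k k)) = rdiag A U k.
    by rewrite -(rdiagE _ _ pA) (Creal_ReP _ (rc_real _)) rcK.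
  by rewrite -rR; apply: (cv_ext c) => m; rewrite rR.
have cvpsi : Un_cv (fun m => renyi_psi al rho sigma (F (phi m)).1 (F (phi m)).2)
    (renyi_psi al rho sigma V om).
  apply: CV_plus; apply: CV_mult (Un_cv_const _) _; apply: Un_cv_sum => k; apply: CV_mult.
  - exact: cvd.
  - by apply: Un_cv_Rpower (cvo k); apply/RltP.
  - exact: cvd.
  - exact: cvo.
exists V, om; split=> //.
apply: (UL_sequence _ _ _ cvpsi) => eps eps0.
have [N [HN N0]] := archimed_cor1 eps eps0.
exists N => m mN; apply/RltP; rewrite RdistE.
have [_ _ E] := hF (phi m); apply: (le_lt_trans E).
have {}N0 : (0 < N)%N by apply/ssrnat.ltP.
move/RltP: HN; apply: le_lt_trans; rewrite RinvE INRE.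
rewrite lef_pV2 ?posrE ?ltr0n // ler_nat.
by apply: leqW; apply: leq_trans (introT ssrnat.leP (phi_ge m)); apply/ssrnat.leP.
Qed.

(** * Measured sums against the sandwiched quantity *)

(** One unitary triangularizes both commuting matrices, and a hermitian triangular matrix is
    diagonal. *)
Lemma commuting_codiag (rho sigma : 'M[K]_n) : posm rho -> posm sigma ->
  rho *m sigma = sigma *m rho -> exists U r s,
  [/\ U \is unitarymx, forall i, 0 < r i, forall i, 0 < s i,
      rho = rspm U r & sigma = rspm U s].
Proof.
move=> prho psig /cotrigonalization2 [P uP /andP[t1 t2]].
have diag A : posm A -> similar_trig P A ->
    exists a, (forall i, 0 < a i) /\ A = rspm (P^t* ) a.
  move=> pA; rewrite /similar_to /= conjymx // => /is_trig_mxP tA.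
  have AE : P *m A *m P^t* = dg (fun i => rc (rp ((P *m A *m P^t* ) i i))).
    have hA : (P *m A *m P^t* )^t* = P *m A *m P^t*.
      by rewrite !adjM trmxCK (proj1 pA) mulmxA.
    have pd i : 0 < (P *m A *m P^t* ) i i.
      have := @posm_diag _ _ (P^t* ) A i _ pA.
      by rewrite trmxCK; apply; rewrite trmxC_unitary.
    apply/matrixP => i j; rewrite [RHS]mxE [X in X *+ _]mxE.
    have [<-|ij] := eqVneq i j; first by rewrite rpK ?mulr1n // gtr0_real.
    rewrite mulr0n; case: (ltngtP i j) => [lt|lt|/ord_inj e].
    - exact: tA.
    - by rewrite -hA adjE tA // conjC0.
    - by rewrite e eqxx in ij.
  exists (fun i => rp ((P *m A *m P^t* ) i i)); split.
    move=> i; have := @posm_diag _ _ (P^t* ) A i _ pA.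
    rewrite trmxC_unitary trmxCK => /(_ uP) p.
    by rewrite -rc_gt0 rpK // gtr0_real.
  rewrite rspmE /spm -AE trmxCK !mulmxA unitary_mulVmx // mul1mx.
  by rewrite -mulmxA unitary_mulVmx // mulmx1.
have [r [r0 rE]] := diag _ prho t1; have [s [s0 sE]] := diag _ psig t2.
by exists (P^t* ), r, s; split=> //; rewrite trmxC_unitary.
Qed.

Definition is_measured_sum (al : R) (rho sigma : 'M[K]_n) (V : R) : Prop :=
  exists (I : finType) (M : I -> 'M[K]_n) (p q : I -> R),
  [/\ forall x, psdm (M x), \sum_x M x = 1%:M,
      forall x, rc (p x) = \tr (rho *m M x), forall x, rc (q x) = \tr (sigma *m M x) &
      V = \sum_x if p x == 0 then 0 else Rpower (p x) al * Rpower (q x) (1 - al)].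

(** The upper bound for [A] turns [p > 0] into [tr M > 0], and the lower bound for [B] then gives
    [q > 0]. *)
Lemma prob_pos (A B M : 'M[K]_n) (p q : R) : posm A -> posm B -> psdm M ->
  rc p = \tr (A *m M) -> rc q = \tr (B *m M) -> p != 0 -> 0 < p /\ 0 < q.
Proof.
move=> pA pB pM pE qE px.
have p0 : 0 < p by rewrite lt_def px -rc_ge0 pE psdm_tr_mul //; exact: posm_psdm.
split=> //; rewrite -rc_gt0 qE.
have [_ [h1 [_ h10 /(_ M pM) /andP[_ B1]]]] := tr_bounds pA.
have [l2 [_ [l20 _ /(_ M pM) /andP[B2 _]]]] := tr_bounds pB.
apply: lt_le_trans B2; rewrite pmulr_rgt0 ?rc_gt0 //.
by rewrite -(pmulr_rgt0 _ (_ : 0 < rc h1)) ?rc_gt0 //; apply: lt_le_trans B1; rewrite -pE rc_gt0.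
Qed.

(** The probabilities sum to [tr rho = 1], so some outcome contributes. This keeps the argument of
    [ln] positive. *)
Lemma measured_sum_gt0 (al : R) (rho sigma : 'M[K]_n) (V : R) :
  psdm rho -> \tr rho = 1 -> is_measured_sum al rho sigma V -> 0 < V.
Proof.
move=> prho tr1 [I [M [p [q [pM M1 pE qE ->]]]]].
have t0 x : 0 <= (if p x == 0 then 0 else Rpower (p x) al * Rpower (q x) (1 - al)).
  by case: eqP => // _; rewrite mulr_ge0 // ltW // rpow_gt0.
rewrite lt_def sumr_ge0 // andbT psumr_eq0 //; apply/negP => /allP h.
have p0 x : p x = 0.
  have := h x (mem_index_enum x); case: (eqVneq (p x) 0) => //= _.
  by rewrite mulf_eq0 !gt_eqF ?rpow_gt0.
have : \tr (rho *m \sum_x M x) = 0.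
  rewrite mulmx_sumr raddf_sum big1 // => x _.
  by rewrite /= -pE p0 rmorph0.
by rewrite M1 mulmx1 tr1 => /eqP; rewrite oner_eq0.
Qed.

Section Comparison.
Variables (al : R) (rho P V : 'M[K]_n) (s x : 'I_n -> R).
Let sigma := rspm P s.
Let e := - ((al - 1) / al / 2).
Hypotheses (uP : P \is unitarymx) (uV : V \is unitarymx).
Hypotheses (s0 : forall i, 0 < s i) (x0 : forall i, 0 < x i).
Hypotheses (al2 : 1 / 2 < al) (al1 : al != 1) (prho : posm rho).
Hypothesis X : rspm P (fun i => Rpower (s i) e) *m rho *m
  rspm P (fun i => Rpower (s i) e) = rspm V x.

Let psig : posm sigma.
Proof. exact: rspm_posm. Qed.

Lemma measured_sum_le (v : R) : is_measured_sum al rho sigma v ->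
  0 <= (al - 1) * (\sum_i Rpower (x i) al - v).
Proof.
move=> [I [M [p [q [pM M1 pE qE ->]]]]].
have [L [H [L0 /(_ I M p q pM M1 pE qE) [U [om [uU B J]]]]]] :=
  measured_psi prho psig al2 al1.
have om0 k : 0 < om k by apply: lt_le_trans L0 _; have /andP[] := B k.
have rE k := rdiagE U k (posm_psdm prho); have qdE k := rdiagE U k (posm_psdm psig).
have [h _] := renyi_bound uP uV uU s0 x0 om0 al2 al1 X rE qdE.
have := addr_ge0 h J; rewrite -mulrDr /renyi_psi; congr (_ <= _ * _).
by rewrite addrA subrK.
Qed.

(** A nearly optimal measurement yields a pair [(U, om)] whose [renyi_psi] lies between its measured
    sum and [Q], hence near [Q]. By [psi_attained] some pair reaches [Q], and there [renyi_bound]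
    holds with equality. *)
Lemma near_optimal_commute :
  (forall eps, 0 < eps -> exists2 v, is_measured_sum al rho sigma v &
     (al - 1) * (\sum_i Rpower (x i) al - v) <= eps) ->
  rho *m sigma = sigma *m rho.
Proof.
move=> h; have [L [H [L0 HM]]] := measured_psi prho psig al2 al1.
have d0 : 0 < `|al - 1| by rewrite normr_gt0 subr_eq0.
have [|U [om [uU om0 E]]] := psi_attained (posm_psdm prho) (posm_psdm psig) L0
   (H := H) (al := al) (Q := \sum_i Rpower (x i) al).
  move=> eps eps0; have [|v vM ve] := h (eps * `|al - 1|); first by rewrite mulr_gt0.
  have [I [M [p [q [pM M1 pE qE vE]]]]] := vM.
  have [U [om [uU B J]]] := HM I M p q pM M1 pE qE.
  exists U, om; split=> //.
  have om0 k : 0 < om k by apply: lt_le_trans L0 _; have /andP[] := B k.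
  have rE k := rdiagE U k (posm_psdm prho); have qdE k := rdiagE U k (posm_psdm psig).
  have [b _] := renyi_bound uP uV uU s0 x0 om0 al2 al1 X rE qdE.
  rewrite -(ler_pM2r d0) distrC mulrC -normrM ger0_norm //.
  apply: le_trans ve; rewrite -vE in J.
  rewrite -subr_ge0; move: J; congr (_ <= _); rewrite /renyi_psi; ring.
have rE k := rdiagE U k (posm_psdm prho); have qdE k := rdiagE U k (posm_psdm psig).
have [_ c] := renyi_bound uP uV uU s0 x0 om0 al2 al1 X rE qdE.
exact: c.
Qed.

Lemma commute_measured_sum : rho *m sigma = sigma *m rho ->
  is_measured_sum al rho sigma (\sum_i Rpower (x i) al).
Proof.
move=> /(commuting_codiag prho psig) [U [r [t [uU r0 t0 rhoE sigE]]]].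
have al0 : 0 < al by apply: lt_trans al2; rewrite divr_gt0.
have aln0 : al != 0 by rewrite gt_eqF.
(* The rank-one projections onto the common eigenbasis. *)
pose M k := rspm U (fun i => (i == k)%:R).
have trM a k : \tr (rspm U a *m M k) = rc (a k).
  rewrite rspmM // tr_rspm // (bigD1 k) //= eqxx mulr1 big1 ?addr0 // => i ik.
  by rewrite (negPf ik) mulr0.
exists 'I_n, M, r, t; split.
- move=> k; rewrite /M rspmE; apply: spm_psdm => i; by rewrite rc_ge0 ler0n.
- rewrite -(rspm1 uU) /M.
  have -> : rspm U (fun=> 1) = rspm U (fun i => \sum_k (i == k)%:R).
    apply: eq_rspm => i; rewrite (bigD1 i) //= eqxx big1 ?addr0 // => k ik.
    by rewrite eq_sym (negPf ik).
  apply/matrixP => i j; rewrite summxE.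
  under eq_bigr => k _ do rewrite rspmE /spm mxE.
  rewrite rspmE /spm mxE exchange_big; apply: eq_bigr => l _ /=.
  by rewrite -mulr_suml mul_dgE rc_sum mulr_sumr; congr (_ * _);
    apply: eq_bigr => k _; rewrite mul_dgE.
- by move=> k; rewrite rhoE trM.
- by move=> k; rewrite sigE trM.
have SE : rspm P (fun i => Rpower (s i) e) = rspm U (fun i => Rpower (t i) e).
  exact: (rspm_fun (fun z => Rpower z e) uP uU sigE).
have XE : rspm V x = rspm U (fun i => Rpower (t i) e * r i * Rpower (t i) e).
  by rewrite -X SE rhoE !rspmM.
have := rspm_fun (fun z => Rpower z al) uV uU XE.
move=> /(congr1 mxtrace); rewrite !tr_rspm // => /rc_inj ->.
apply: eq_bigr => i _ /=; rewrite gt_eqF //.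
have te : 0 < Rpower (t i) e by exact: rpow_gt0.
(* The exponents of [t i] combine to [2 e al = 1 - al]. *)
rewrite -mulrA (mulrC (r i)) mulrA -rpowD rpow_mull ?rpow_gt0 // rpowM mulrC.
congr (_ * Rpower _ _); rewrite /e.
rewrite -opprD -splitr mulNr divfK // opprB //.
Qed.
End Comparison.

End Embedding.

(** * Translation of the concrete matrices *)

Section Translation.
Variable d : nat.
Local Notation cR := (complex R).
Local Notation rcc := (real_complex R).

Definition toC (z : Defs.C) : cR := Complex (re z) (im z).
Definition ofC (z : cR) : Defs.C := mkC (complex.Re z) (complex.Im z).

Lemma ofCK z : toC (ofC z) = z. Proof. by case: z. Qed.
Lemma toCK z : ofC (toC z) = z. Proof. by case: z. Qed.
Lemma toC_inj : injective toC. Proof. exact: can_inj toCK. Qed.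

Lemma toCM a b : toC (Cmul a b) = toC a * toC b. Proof. by []. Qed.
Lemma toC_conj a : toC (Cconj a) = (toC a)^*. Proof. by []. Qed.

Lemma toC_sum n (f : nat -> Defs.C) : toC (Csum n f) = \sum_(i < n) toC (f i).
Proof.
have seqE a m : List.seq a m = iota a m.
  by elim: m a => //= m IH a; rewrite IH.
rewrite -(big_mkord predT (fun i => toC (f i))) /index_iota subn0 /Csum seqE.
elim: (iota 0 n) => [|i s IH]; first by rewrite big_nil.
by rewrite big_cons -IH.
Qed.

Definition toM (A : Mat) : 'M[cR]_d := \matrix_(i, j) toC (A i j).

Definition fromM (M : 'M[cR]_d) : Mat := fun i j =>
  match @idP (i < d)%N, @idP (j < d)%N with
  | ReflectT hi, ReflectT hj => ofC (M (Ordinal hi) (Ordinal hj))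
  | _, _ => C0
  end.

Lemma fromMK M : toM (fromM M) = M.
Proof.
apply/matrixP => i j; rewrite mxE /fromM.
case: {-}_ / idP => [hi|]; last by rewrite ltn_ord.
case: {-}_ / idP => [hj|]; last by rewrite ltn_ord.
by rewrite ofCK; congr (M _ _); exact: val_inj.
Qed.

Lemma mat_eqP A B : mat_eq d A B <-> toM A = toM B.
Proof.
split=> [h|/matrixP h i j /ssrnat.ltP hi /ssrnat.ltP hj].
  by apply/matrixP => i j; rewrite !mxE h //; apply/ssrnat.ltP.
by have := h (Ordinal hi) (Ordinal hj); rewrite !mxE => /toC_inj.
Qed.

Lemma toM_mul A B : toM (mmul d A B) = toM A *m toM B.
Proof.
by apply/matrixP => i j; rewrite !mxE toC_sum; apply: eq_bigr => k _; rewrite !mxE.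
Qed.

Lemma toM_adj A : toM (adj A) = (toM A)^t*.
Proof. by apply/matrixP => i j; rewrite adjE !mxE. Qed.

Lemma toM_Id : toM Id = 1%:M.
Proof.
apply/matrixP => i j; rewrite !mxE /Id; have [<-|ij] := eqVneq i j.
  by rewrite Nat.eqb_refl.
rewrite (proj2 (Nat.eqb_neq i j)) // => /val_inj e.
by rewrite e eqxx in ij.
Qed.

Lemma toM_diagm (lam : nat -> R) : toM (diagm lam) = dg (fun i : 'I_d => rcc (lam i)).
Proof.
apply/matrixP => i j; rewrite !mxE /diagm; have [<-|ij] := eqVneq i j.
  by rewrite Nat.eqb_refl.
rewrite (proj2 (Nat.eqb_neq i j)) // => /val_inj e.
by rewrite e eqxx in ij.
Qed.

Lemma toM_trace A : toC (trace d A) = \tr (toM A).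
Proof. by rewrite toC_sum; apply: eq_bigr => i _; rewrite mxE. Qed.

Lemma toM_msum Ms : toM (msum Ms) = \sum_(M <- Ms) toM M.
Proof.
elim: Ms => [|M Ms IH]; first by rewrite big_nil; apply/matrixP => i j; rewrite !mxE.
by rewrite big_cons -IH; apply/matrixP => i j; rewrite !mxE.
Qed.

Definition toV (v : nat -> Defs.C) : 'cV[cR]_d := \col_i toC (v i).
Definition fromV (v : 'cV[cR]_d) : nat -> Defs.C := fun i =>
  match @idP (i < d)%N with ReflectT hi => ofC (v (Ordinal hi) 0) | _ => C0 end.

Lemma fromVK v : toV (fromV v) = v.
Proof.
apply/matrixP => i j; rewrite mxE /fromV ord1.
case: {-}_ / idP => [hi|]; last by rewrite ltn_ord.
by rewrite ofCK; congr (v _ _); exact: val_inj.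
Qed.

Lemma toC_qform A v : toC (qform d A v) = ((toV v)^t* *m toM A *m toV v) 0 0.
Proof.
rewrite toC_sum -mulmxA mxE; apply: eq_bigr => i _.
rewrite toCM toC_conj toC_sum adjE !mxE; congr (_ * _).
by apply: eq_bigr => j _; rewrite !mxE toCM.
Qed.

(** The concrete [psd] and [posdef] constrain only the real part of the form, whereas the order on
    complex numbers also asserts realness; hermiticity supplies it. *)
Lemma quad_real (M : 'M[cR]_d) (v : 'cV[cR]_d) : M^t* = M ->
  (v^t* *m M *m v) 0 0 = rcc (complex.Re ((v^t* *m M *m v) 0 0)).
Proof.
move=> hM; rewrite RRe_real //; apply/CrealP.
by rewrite -adjE !adjM trmxCK hM mulmxA.
Qed.

Lemma psd_toM A : psd d A <-> psdm (toM A).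
Proof.
split=> [[/mat_eqP h p]|[h p]].
  have hA : (toM A)^t* = toM A by rewrite -toM_adj.
  split=> // v; rewrite quad_real // ler0c -{1 2}(fromVK v) -toC_qform.
  by apply/RleP; exact: p.
split; first by apply/mat_eqP; rewrite toM_adj h.
move=> v; apply/RleP; have := p (toV v); rewrite -toC_qform.
by rewrite lecE => /andP[].
Qed.

Lemma posdef_toM A : posdef d A -> posm (toM A).
Proof.
move=> [/mat_eqP h p]; have hA : (toM A)^t* = toM A by rewrite -toM_adj.
split=> // v v0; rewrite quad_real // -[0]/(rcc 0) ltcR -{1 2}(fromVK v) -toC_qform.
apply/RltP; apply: p; move: v0; rewrite -{1}(fromVK v) => v0.
apply: NNPP => n; case/negP: v0; apply/eqP/matrixP => i j; rewrite !mxE.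
rewrite -[0]/(toC C0); congr toC; apply: NNPP => ni; apply: n; exists (i : nat).
by split=> //; apply/ssrnat.ltP.
Qed.

Lemma unitary_toM U : unitary d U <-> toM U \is unitarymx.
Proof.
rewrite /unitary; split=> [/mat_eqP|/unitary_mulVmx h].
  rewrite toM_mul toM_adj toM_Id => /mulmx1C h.
  by apply/unitarymxP.
by apply/mat_eqP; rewrite toM_mul toM_adj toM_Id.
Qed.

Lemma toM_spectral U lam : toM (mmul d (mmul d U (diagm lam)) (adj U)) =
  rspm rcc (toM U) (fun i : 'I_d => lam i).
Proof. by rewrite rspmE !toM_mul toM_adj toM_diagm. Qed.

(** [mpow] is an [epsilon] choice. The spectral theorem shows that a power exists, so the chosen
    matrix satisfies [is_mpow], and the diagonalization returned is the one behind that choice. *)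
Lemma mpow_spec A (t : R) : psd d A -> exists U (lam : 'I_d -> R),
  [/\ U \is unitarymx, toM A = rspm rcc U lam &
      toM (mpow d A t) = rspm rcc U (fun i => rpow (lam i) t)].
Proof.
move=> /psd_toM pA.
have ex : exists Q, is_mpow d A t Q.
  have [U [a [uU ra E]]] := hermitian_spectral (proj1 pA).
  pose lam (i : nat) : R := match @idP (i < d)%N with
    ReflectT hi => complex.Re (a (Ordinal hi)) | _ => 0 end.
  have lamE (i : 'I_d) : lam i = complex.Re (a i).
    rewrite /lam; case: {-}_ / idP => [hi|]; last by rewrite ltn_ord.
    by congr (complex.Re (a _)); exact: val_inj.
  exists (mmul d (mmul d (fromM U) (diagm (fun i => rpow (lam i) t))) (adj (fromM U))).
  exists (fromM U), lam; split; first by apply/unitary_toM; rewrite fromMK.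
  split.
    move=> i /ssrnat.ltP hi; apply/RleP; rewrite (lamE (Ordinal hi)).
    have a0 : 0 <= a (Ordinal hi) by apply: (psdm_spm_ge0 _ uU); rewrite -E.
    by move: a0; rewrite lecE => /andP[].
  split=> //; apply/mat_eqP; rewrite toM_spectral fromMK rspmE E; apply: eq_spm => i.
  by rewrite lamE; exact: esym (RRe_real (ra i)).
have [U [lam [/unitary_toM uU [_ [/mat_eqP E1 /mat_eqP E2]]]]] :=
  epsilon_spec (inhabits mzero) _ ex.
exists (toM U), (fun i => lam i); split=> //; first by rewrite E1 toM_spectral.
by rewrite /mpow E2 toM_spectral.
Qed.

Lemma rpowE (x t : R) : 0 < x -> rpow x t = Rpower x t.
Proof. by move=> /RltP x0; rewrite /rpow; case: Rlt_dec. Qed.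

Lemma mpow_posm A (t : R) : psd d A -> posm (toM A) -> exists U (lam : 'I_d -> R),
  [/\ U \is unitarymx, forall i, 0 < lam i, toM A = rspm rcc U lam &
      toM (mpow d A t) = rspm rcc U (fun i => Rpower (lam i) t)].
Proof.
move=> pA pA'; have [U [lam [uU E1 E2]]] := mpow_spec t pA.
have l0 i : 0 < lam i.
  rewrite -(ltcR 0); apply: (@posm_spm_gt0 _ _ _ (fun i => rcc (lam i)) i uU).
  by rewrite -rspmE -E1.
exists U, lam; split; [exact: uU|exact: l0|exact: E1|].
rewrite E2 !rspmE; apply: eq_spm => i; by rewrite rpowE.
Qed.

Lemma rcc_le (x y : R) : (rcc x <= rcc y) = (x <= y).
Proof. exact: lecR. Qed.

Lemma Re_realK (z : cR) : z \is Num.real -> rcc (complex.Re z) = z.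
Proof. exact: RRe_real. Qed.

Lemma prob_toM A M : psd d A -> psd d M ->
  rcc (prob d A M) = \tr (toM A *m toM M).
Proof.
move=> /psd_toM pA /psd_toM pM.
have E : toC (trace d (mmul d M A)) = \tr (toM A *m toM M).
  by rewrite toM_trace toM_mul mxtrace_mulC.
have r : toC (trace d (mmul d M A)) \is Num.real.
  by rewrite E ger0_real // psdm_tr_mul.
by rewrite -E; exact: (Re_realK r).
Qed.

(** Congruence by an invertible power of [sigma] keeps [rho] positive definite, so the eigenvalues
    [x] are positive and the trace becomes a sum of real powers. *)
Lemma sandwiched_spec rho sigma al :
  posdef d rho -> posdef d sigma -> psd d sigma -> al != 0 ->
  exists (P V : 'M[cR]_d) (s x : 'I_d -> R),
  [/\ P \is unitarymx /\ V \is unitarymx, forall i, 0 < s i, forall i, 0 < x i,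
    toM sigma = rspm rcc P s /\
      let e := - ((al - 1) / al / 2) in
      rspm rcc P (fun i => Rpower (s i) e) *m toM rho *m
        rspm rcc P (fun i => Rpower (s i) e) = rspm rcc V x &
    sandwiched d al rho sigma = (al - 1)^-1 * ln (\sum_i Rpower (x i) al)].
Proof.
move=> /posdef_toM prho /posdef_toM psig psig' al0.
have [P [s [uP s0 sE SE]]] := mpow_posm ((1 - al) / (2 * al)) psig' psig.
set S := mpow _ _ _ in SE; set X := mmul d (mmul d S rho) S.
have XE : toM X = toM S *m toM rho *m toM S by rewrite !toM_mul.
have pX : posm (toM X).
  have hS : (toM S)^t* = toM S by rewrite SE; exact: (adj_rspm rcc_le).
  split; first by rewrite XE !adjM hS (proj1 prho) mulmxA.
  move=> v v0; have -> : v^t* *m toM X *m v = (toM S *m v)^t* *m toM rho *m (toM S *m v).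
    by rewrite XE adjM hS !mulmxA.
  apply: (proj2 prho); apply: contra v0 => /eqP h; apply/eqP.
  rewrite -[v]mul1mx -(rspm_pow_invl rcc ((1 - al) / (2 * al))%R uP s0).
  by rewrite -SE -mulmxA h mulmx0.
have pX' : psd d X by apply/psd_toM/posm_psdm.
have [V [x [uV x0 xE QE]]] := mpow_posm al pX' pX.
exists P, V, s, x; split; [by split|exact: s0|exact: x0| |].
  split; [exact: sE|rewrite /= -xE XE SE].
  have -> : - ((al - 1) / al / 2) = (1 - al) / (2 * al).
    by field.
  by [].
rewrite /sandwiched -/S -/X; congr (_ * ln _).
have := tr_rspm rcc (fun i => Rpower (x i) al) uV; rewrite -QE -toM_trace.
by move=> /(congr1 (@complex.Re R)).
Qed.

Lemma mem_nth_In (T : Type) (x : T) (l : seq T) i : (i < size l)%N ->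
  List.In (seq.nth x l i) l.
Proof. by elim: l i => //= y l IH [|i] /= h; [left | right; apply: IH]. Qed.

Lemma measured_valueE rho sigma al Ms : psd d rho -> psd d sigma ->
  posdef d rho -> posdef d sigma -> List.Forall (psd d) Ms ->
  measured_value d al rho sigma Ms = (al - 1)^-1 * ln (\sum_(M <- Ms)
    if prob d rho M == 0 then 0
    else Rpower (prob d rho M) al * Rpower (prob d sigma M) (1 - al)).
Proof.
move=> pr ps pr' ps' h; rewrite /measured_value; congr (_ * ln _).
elim: Ms h => [|M Ms IH] h; first by rewrite big_nil.
have pM := Forall_inv h; rewrite big_cons -IH; last exact: Forall_inv_tail h.
rewrite /=; congr Rplus; case: RIneq.Req_EM_T => p0 /=; first by rewrite p0 R0E eqxx.
have /eqP p0' : prob d rho M <> 0 by []; rewrite (negPf p0').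
have [p q] := prob_pos rcc_le Re_realK (posdef_toM pr') (posdef_toM ps')
   (proj1 (psd_toM M) pM) (prob_toM pr pM) (prob_toM ps pM) p0'.
by rewrite !rpowE.
Qed.

Lemma measured_valuesP rho sigma al v : psd d rho -> psd d sigma ->
  posdef d rho -> posdef d sigma ->
  measured_values d al rho sigma v <->
  exists V, is_measured_sum rcc al (toM rho) (toM sigma) V /\ v = (al - 1)^-1 * ln V.
Proof.
move=> pr ps pr' ps'; split=> [[Ms [[psdMs /mat_eqP idMs] ->]]|[V [HV ->]]].
  exists (\sum_(M <- Ms) if prob d rho M == 0 then 0
     else Rpower (prob d rho M) al * Rpower (prob d sigma M) (1 - al)); split; last first.
    exact: measured_valueE.
  have pM (i : 'I_(size Ms)) : psd d (tnth (in_tuple Ms) i).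
    rewrite (tnth_nth mzero) /=.
    have /Forall_forall := psdMs; apply; apply: mem_nth_In; exact: ltn_ord.
  (* Indexing by position keeps repeated elements of the list apart. *)
  exists 'I_(size Ms), (fun i => toM (tnth (in_tuple Ms) i)),
    (fun i => prob d rho (tnth (in_tuple Ms) i)),
    (fun i => prob d sigma (tnth (in_tuple Ms) i)); split.
  - by move=> i; apply/psd_toM.
  - by rewrite -toM_Id -idMs toM_msum [RHS]big_tnth.
  - by move=> i; exact: prob_toM.
  - by move=> i; exact: prob_toM.
  - by rewrite [LHS]big_tnth.
have [I [M [p [q [pM M1 pE qE ->]]]]] := HV.
pose Ms := [seq fromM (M x) | x <- index_enum I].
have psdM x : psd d (fromM (M x)) by apply/psd_toM; rewrite fromMK.
have psdMs : List.Forall (psd d) Ms.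
  by rewrite /Ms; elim: (index_enum I) => //= x s IH; apply: Forall_cons.
exists Ms; split.
  split=> //; apply/mat_eqP; rewrite toM_msum toM_Id -M1 big_map.
  by apply: eq_bigr => x _; rewrite fromMK.
rewrite measured_valueE //; congr (_ * ln _).
rewrite big_map; apply: eq_bigr => x _.
have -> : prob d rho (fromM (M x)) = p x.
  by apply: complexI; rewrite prob_toM // fromMK -pE.
have -> // : prob d sigma (fromM (M x)) = q x.
by apply: complexI; rewrite prob_toM // fromMK -qE.
Qed.
End Translation.

(** * From sums to entropies *)

Lemma posdef_psd n A : posdef n A -> psd n A.
Proof. by move=> pA; apply/psd_toM/posm_psdm/posdef_toM. Qed.

Lemma ln_le_iff (x y : R) : 0 < x -> 0 < y -> (ln x <= ln y) = (x <= y).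
Proof.
move=> /RltP x0 /RltP y0; apply/idP/idP => /RleP h; apply/RleP.
  by apply: Rnot_lt_le => yx; exact: Rlt_not_le (ln_increasing _ _ y0 yx) h.
by apply: Rnot_lt_le => yx; exact: Rlt_not_le (ln_lt_inv _ _ y0 x0 yx) h.
Qed.

(** For [al < 1] the prefactor reverses the order, and so does [al - 1] on the right; one signed
    condition covers both regimes. *)
Lemma renyi_le_iff (al V Q : R) : al != 1 -> 0 < V -> 0 < Q ->
  ((al - 1)^-1 * ln V <= (al - 1)^-1 * ln Q) = (0 <= (al - 1) * (Q - V)).
Proof.
move=> al1 V0 Q0; have [lt|gt|e] := ltgtP al 1; last by rewrite e eqxx in al1.
  have c : al - 1 < 0 by rewrite subr_lt0.
  rewrite ler_nM2l ?invr_lt0 // ln_le_iff // nmulr_rge0 //.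
  by rewrite subr_le0.
have c : 0 < al - 1 by rewrite subr_gt0.
by rewrite ler_pM2l ?invr_gt0 // ln_le_iff // pmulr_rge0 // subr_ge0.
Qed.

(** [Q'] is moved strictly to the side of [Q] that lowers the entropy; for [al > 1] the cap [Q / 2]
    keeps it positive. It will serve as a competing upper bound. *)
Lemma renyi_slack (al Q eps : R) : al != 1 -> 0 < Q -> 0 < eps ->
  exists Q', [/\ 0 < Q', 0 < (al - 1) * (Q - Q') & (al - 1) * (Q - Q') <= eps].
Proof.
move=> al1 Q0 e0; have [lt|gt|e] := ltgtP al 1; last by rewrite e eqxx in al1.
  have c : 0 < 1 - al by rewrite subr_gt0.
  exists (Q + eps / (1 - al)).
  have -> : (al - 1) * (Q - (Q + eps / (1 - al))) = eps by field; rewrite gt_eqF.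
  by split=> //; rewrite addr_gt0 // divr_gt0.
have c : 0 < al - 1 by rewrite subr_gt0.
pose m := Num.min (eps / (al - 1)) (Q / 2).
have m0 : 0 < m by rewrite lt_min !divr_gt0.
exists (Q - m); rewrite opprB addrCA subrr addr0; split.
- rewrite subr_gt0 gt_min; apply/orP; right.
  by rewrite ltr_pdivrMr // ltr_pMr // ltr1n.
- exact: mulr_gt0.
- by rewrite mulrC -ler_pdivlMr // ge_min lexx.
Qed.

Lemma measured_renyi_comparison (d : nat) (rho sigma : Mat) (alpha : R) :
  density d rho -> posdef d rho -> posdef d sigma ->
  (Rlt (Rdiv (IZR 1) (IZR 2)) alpha /\ Rlt alpha (IZR 1)) \/ Rlt (IZR 1) alpha ->
  (forall v, measured_values d alpha rho sigma v -> Rle v (sandwiched d alpha rho sigma)) /\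
  (is_lub (measured_values d alpha rho sigma) (sandwiched d alpha rho sigma)
     <-> commute d rho sigma).
Proof.
move=> [_ tr1] pr' ps' hal.
have pr := posdef_psd pr'; have ps := posdef_psd ps'.
have h2 : Rlt (Rdiv (IZR 1) (IZR 2)) alpha by case: hal => h; Lra.lra.
have h1 : alpha <> IZR 1 by case: hal => h; Lra.lra.
have al2 : 1 / 2 < alpha by apply/RltP.
have al1 : alpha != 1 by apply/eqP.
have al0 : alpha != 0.
  by rewrite gt_eqF //; apply: lt_trans al2; rewrite divr_gt0.
have trR : \tr (toM d rho) = 1 by rewrite -toM_trace tr1.
have [P [V [s [x [[uP uV] s0 x0 [sE XE] DE]]]]] := sandwiched_spec pr' ps' ps al0.
have prM := posdef_toM pr'.
set Q := \sum_i Rpower (x i) alpha in DE.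
have gt0 v : is_measured_sum (real_complex R) alpha (toM d rho) (toM d sigma) v -> 0 < v.
  exact: (measured_sum_gt0 (posm_psdm prM) trR).
(* Trace [1] forces a positive dimension; otherwise [Q] would be an empty sum and its logarithm a
   default value. *)
have n0 : (0 < d)%N.
  case: (posnP d) => // d0; have := trR; rewrite /mxtrace big1 => [/eqP|i _].
    by rewrite eq_sym oner_eq0.
  by exfalso; have := leq_ltn_trans (leq0n i) (ltn_ord i); rewrite d0.
have Q0 : 0 < Q.
  rewrite /Q (bigD1 (Ordinal n0)) //= ltr_wpDr ?rpow_gt0 //.
  by apply: sumr_ge0 => i _; rewrite ltW // rpow_gt0.
have bound v : is_measured_sum (real_complex R) alpha (toM d rho) (toM d sigma) v ->
    0 <= (alpha - 1) * (Q - v).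
  by rewrite sE; apply: (measured_sum_le rcc_le Re_realK uP uV s0 x0 al2 al1 prM XE).
have ub v : measured_values d alpha rho sigma v -> Rle v (sandwiched d alpha rho sigma).
  move=> /measured_valuesP [] // w [wM ->]; rewrite DE; apply/RleP.
  by rewrite (renyi_le_iff al1 (gt0 _ wM) Q0); exact: bound.
split=> //; split=> [[_ lub]|com].
  apply/mat_eqP; rewrite !toM_mul sE.
  apply: (near_optimal_commute rcc_le Re_realK uP uV s0 x0 al2 al1 prM XE) => eps eps0.
  (* If no measured sum comes within [eps] of [Q], the entropy of [Q'] is an upper bound strictly
     below the least one. *)
  apply: NNPP => no.
  have [Q' [Q'0 lt le]] := renyi_slack al1 Q0 eps0.
  have : Rle (sandwiched d alpha rho sigma) ((alpha - 1)^-1 * ln Q').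
    apply: lub => v /measured_valuesP [] // w [wM ->]; apply/RleP.
    rewrite (renyi_le_iff al1 (gt0 _ wM) Q'0); apply: contraT; rewrite -ltNge => lt'.
    exfalso; apply: no; exists w; first by rewrite -sE.
    apply: le_trans le; rewrite -subr_ge0 -mulrBr opprB [X in _ * X]addrC addrA.
    by rewrite subrK -[w - Q']opprB mulrN oppr_ge0 ltW.
  rewrite DE => /RleP; rewrite (renyi_le_iff al1 Q0 Q'0) leNgt => /negP; apply.
  by rewrite -[Q' - Q]opprB mulrN oppr_lt0.
(* The sandwiched value is itself a measured value, so every upper bound [b] dominates it. *)
split=> // b; apply; apply/measured_valuesP => //; exists Q; split; last exact: DE.
rewrite sE; apply: (commute_measured_sum rcc_le Re_realK uP uV s0 al2 prM XE).
by move/mat_eqP: com; rewrite !toM_mul sE.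
Qed.

Open Scope R_scope.

(* D^M_alpha is the supremum of [measured_values]; "D^M <= D" is stated as
   D being an upper bound of that set, and "D^M = D" as D being its least
   upper bound. *)
Theorem theorem6 (d : nat) (rho sigma : Mat) (alpha : R) :
  density d rho -> posdef d rho -> posdef d sigma ->
  ((1/2 < alpha < 1) \/ 1 < alpha) ->
  (forall v, measured_values d alpha rho sigma v -> v <= sandwiched d alpha rho sigma) /\
  (is_lub (measured_values d alpha rho sigma) (sandwiched d alpha rho sigma)
     <-> commute d rho sigma).
Proof. exact: measured_renyi_comparison. Qed.
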